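(* (i) Fix a real number $\alpha$ that occurs as an eigenvalue of (the adjacency matrix of) some finite tree. There exist constants $\mu_{\mathrm{rec},\alpha}$ and $\sigma^2_{\mathrm{rec},\alpha}$ such that the multiplicity $N_\alpha(\mathcal{R}_n)$ of $\alpha$ as an eigenvalue of the random recursive tree $\mathcal{R}_n$ with $n$ vertices satisfies, as $n\to\infty$, \[\frac{N_{\alpha}(\mathcal{R}_n)-\mu_{\mathrm{rec},\alpha}\,n}{\sqrt{n}}\xrightarrow{d}\mathcal{N}(0,\sigma^2_{\mathrm{rec},\alpha}).\] (ii) Likewise, suppose that the real number $\alpha$ occurs as an eigenvalue of some finite binary tree. There exist constants $\mu_{\mathrm{bin},\alpha}$ and $\sigma^2_{\mathrm{bin},\alpha}$ such that the multiplicity $N_{\alpha}(\mathcal{B}_n)$ of $\alpha$ as an eigenvalue of the random binary increasing tree $\mathcal{B}_n$ with $n$ vertices satisfies, as $n\to\infty$, \[\frac{N_{\alpha}(\mathcal{B}_n)-\mu_{\mathrm{bin},\alpha}\,n}{\sqrt{n}}\xrightarrow{d}\mathcal{N}(0,\sigma^2_{\mathrm{bin},\alpha}).\]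
   Context: A recursive tree with $n$ vertices is a rooted (unordered) tree with vertex labels $1,\dots,n$, each used once, whose labels increase along every path starting at the root. There are $(n-1)!$ of them, and the random recursive tree $\mathcal{R}_n$ is uniformly distributed among them. Equivalently, start with a root labelled $1$ and, for $k=2,\dots,n$, attach vertex $k$ to one of the previous $k-1$ vertices chosen uniformly at random. A binary tree is a rooted tree in which every vertex has at most one left child and at most one right child. A binary increasing tree with $n$ vertices is a binary tree with vertex labels $1,\dots,n$, each used once, increasing along every path starting at the root. There are $n!$ of them, and the random binary increasing tree $\mathcal{B}_n$ is uniformly distributed among them. Eigenvalues of a tree are the eigenvalues of the adjacency matrix of the underlying undirected graph; $N_\alpha(T)$ is the multiplicity of $\alpha$ as an eigenvalue of $T$ ($0$ if $\alpha$ is not an eigenvalue). $\mathcal{N}(\mu,\sigma^2)$ denotes the normal distribution with mean $\mu$ and variance $\sigma^2\ge 0$ (a point mass at $\mu$ if $\sigma^2=0$), and $\xrightarrow{d}$ denotes convergence in distribution. *)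

(* Defs.v *)
From HB Require Import structures.
From mathcomp Require Import all_boot all_order all_algebra.
From mathcomp Require Import all_classical all_reals all_analysis.

Set Implicit Arguments.
Unset Strict Implicit.
Unset Printing Implicit Defensive.

Import Order.TTheory GRing.Theory Num.Theory.
Import numFieldTopology.Exports numFieldNormedType.Exports.

Local Open Scope ring_scope.

(* A finite simple graph on n vertices is a symmetric irreflexive relation;
   a tree is a nonempty connected graph without cycles of length >= 3. *)
Definition is_tree n (e : rel 'I_n) : Prop :=
  [/\ (0 < n)%N, symmetric e, irreflexive e,
      forall u v, connect e u v
    & forall c : seq 'I_n, ucycle e c -> (size c <= 2)%N].

Definition adjacency (R : nzRingType) n (e : rel 'I_n) : 'M[R]_n :=
  \matrix_(i, j) (e i j)%:R.

(* The matrices used below are symmetric, so the algebraic multiplicity is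
   also the dimension of the eigenspace. *)
Definition eigen_mult (R : fieldType) n (e : rel 'I_n) (a : R) : nat :=
  mup a (char_poly (adjacency R e)).

(* A rooted unordered tree with vertex set 'I_n is given by its parent map:
   [p v = None] iff v is the root.  The vertices 0, ..., n-1 of 'I_n stand
   for the labels 1, ..., n. *)
Definition parent_map n := {ffun 'I_n -> option 'I_n}.

Definition is_rooted_tree n (p : parent_map n) : bool :=
  [exists r, (p r == None) &&
     [forall v, connect (fun a b => p a == Some b) v r]].

Definition underlying_graph n (p : parent_map n) : rel 'I_n :=
  fun u v => (p u == Some v) || (p v == Some u).

(* Every edge lies on a path from the root, so labels increase along all such
   paths iff every vertex has a larger label than its parent. *)
Definition increasing_labels n (p : parent_map n) : bool :=
  [forall u, forall v, (p v == Some u) ==> (u < v)%N].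

Definition recursive_trees n : {set parent_map n} :=
  finset (fun p => is_rooted_tree p && increasing_labels p).

(* In a binary tree, [b v = Some (u, s)] says that v is the left (s = false) or
   right (s = true) child of u. *)
Definition binary_map n := {ffun 'I_n -> option ('I_n * bool)}.

Definition forget_sides n (b : binary_map n) : parent_map n :=
  [ffun v => omap fst (b v)].

Definition is_binary_tree n (b : binary_map n) : bool :=
  is_rooted_tree (forget_sides b) &&
  [forall u, forall s, (#|[pred v | b v == Some (u, s)]| <= 1)%N].

Definition binary_increasing_trees n : {set binary_map n} :=
  finset (fun b => is_binary_tree b && increasing_labels (forget_sides b)).

(* Law of X(T) for T uniform on the finite set S.  For S empty, which below
   happens only for n = 0, this is the zero measure. *)
Definition uniform_law (R : realType) (T : finType) (S : {set T}) (X : T -> R)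
    (A : set R) : \bar R :=
  (#|[pred t in S | X t \in A]|%:R / #|S|%:R)%:E.

(* N(m, v) with v the variance; [normal_prob] takes the standard deviation and
   is not a point mass when the latter is 0. *)
Definition normal_law (R : realType) (m v : R) : set R -> \bar R :=
  if v == 0 then \d_m else normal_prob m (Num.sqrt v).

Definition distr_fun (R : realType) (mu : set R -> \bar R) (x : R) : \bar R :=
  mu `]-oo, x]%classic.

Definition cvg_in_distribution (R : realType) (mu_ : nat -> set R -> \bar R)
    (mu : set R -> \bar R) : Prop :=
  forall x : R, {for x, continuous (distr_fun mu)} ->
    (distr_fun (mu_ n) x @[n --> \oo] --> distr_fun mu x)%classic.

(* Main.v *)
From HB Require Import structures.
Require Import Defs.
From mathcomp Require Import all_boot all_order all_algebra.
From mathcomp Require Import all_classical all_reals all_analysis.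
From mathcomp Require Import ring lra zify.
Set Implicit Arguments.
Unset Strict Implicit.
Unset Printing Implicit Defensive.
Import Order.TTheory GRing.Theory Num.Theory.
Import numFieldTopology.Exports numFieldNormedType.Exports.
Local Open Scope ring_scope.

(* Cutting a recursive tree at the edge between the vertices 1 and 2, or a
   binary increasing tree at its root, yields two trees that are independent
   given their sizes, the first size being uniform.  So both models are coded by
   the same random binary shape, grown by replacing uniform leaves by forks, and
   the multiplicity of [alpha] changes at such a cut by a bounded amount, since
   the adjacency matrix changes by a matrix of bounded rank.  It remains to prove
   a central limit theorem for an additive functional [F] of shapes with bounded
   toll.

   The quicksort recurrence gives a mean [mu (n + 1) + O(1)] and a variance
   [v n = sigma2 (n + 1) + O(sqrt n)].  Let [u s y = Phi (y / sqrt s)], a solution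
   of the heat equation.  If [X n] is the centered functional, then
   [E (u s (y - X n))] is [u (s + v n) y] up to [O(n log n) s ^ (-3/2)]: by
   induction on [n], split [X n] into two independent parts and a toll, and
   expand to second order, where all terms cancel because the first two moments
   match and [u] satisfies the heat equation.  Taking [s] to be a small multiple
   of [n] smooths the distribution function of [X n / sqrt n]. *)

(** For a symmetric matrix the multiplicity of an eigenvalue is a corank, so the effect of a cut is
    read off from ranks: one edge contributes two outer products.

    On the probabilistic side the toll depends on both parts, and its correlation with them limits
    the variance estimate to an error O(sqrt n). This dictates the amount of smoothing. Replacing
    the time s + v i + v j by s + v n is a shift by O(sqrt n) over a range of times of length O(n),
    with remainder O(n sqrt n / s^2); this matches the space remainder O(n s^(-3/2)) when s is at
    least of order n. In the quicksort recurrence a toll of order n costs a factor log n, which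
    s^(3/2) still outweighs.

    The second-order terms in space and in time are both multiples of the second derivative of u at
    the same point (s, y). They cancel only after averaging over the sizes of the two parts, not for
    each split. Because s stays positive, the case sigma2 = 0 is treated together with the
    nondegenerate one until the smoothing is removed. *)

(* Sylvester's identity, via the two triangular factorizations of the block
   matrix [Y, C; D, 1]. *)
Lemma det_scalar_sub_mulmxC (R : comNzRingType) (n r : nat)
    (C : 'M[R]_(n, r)) (D : 'M[R]_(r, n)) (Y : R) :
  Y ^+ r * \det (Y%:M - C *m D) = Y ^+ n * \det (Y%:M - D *m C).
Proof.
pose M := block_mx Y%:M C D 1%:M.
have e1 : \det M = \det (Y%:M - C *m D).
  have : M *m block_mx 1%:M 0 (- D) 1%:M = block_mx (Y%:M - C *m D) C 0 1%:M.
    rewrite mulmx_block !mulmx1 !mulmx0 !mul1mx !add0r mulmxN.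
    by rewrite addrN.
  move=> /(congr1 determinant); rewrite det_mulmx det_lblock det_ublock.
  by rewrite !det1 !mulr1.
have : block_mx 1%:M 0 (- D) Y%:M *m M = block_mx Y%:M C 0 (Y%:M - D *m C).
  rewrite mulmx_block !mul1mx !mul0mx !addr0 mulmx1.
  by rewrite mul_mx_scalar mul_scalar_mx scalerN addNr mulNmx addrC.
move=> /(congr1 determinant); rewrite det_mulmx det_lblock det_ublock.
by rewrite !det1 mul1r !det_scalar e1.
Qed.

(** A row [z] with [z *m z^T = 0] has a vanishing sum of squares, so over an ordered field the row
    space of [A] meets the kernel of [A^T] trivially. *)
Lemma mxrank_mul_trmx (R : realFieldType) (m n : nat) (A : 'M[R]_(m, n)) :
  \rank (A *m A^T) = \rank A.
Proof.
rewrite -[RHS](mxrank_mul_ker A A^T) (_ : (A :&: kermx A^T)%MS = 0) ?mxrank0 ?addn0 //.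
apply/eqP; rewrite -submx0; apply/rV_subP => x.
rewrite sub_capmx => /andP[/submxP[y ->]] /sub_kermxP yA0.
have : (y *m A) *m (y *m A)^T = 0 by rewrite trmx_mul mulmxA yA0 mul0mx.
move: (y *m A) => z /matrixP/(_ 0 0); rewrite !mxE => z0.
suff -> : z = 0 by rewrite sub0mx.
apply/rowP => j; apply/eqP; rewrite mxE -sqrf_eq0.
move/eqP: z0; rewrite psumr_eq0 => [|i _]; last by rewrite mxE -expr2 sqr_ge0.
by move=> /allP/(_ j (mem_index_enum _)); rewrite /= mxE -expr2.
Qed.

(** Factor [A - a%:M] as [C *m D] through its rank [r]. Sylvester's identity then extracts the power
    [n - r] of ['X - a%:P] from the characteristic polynomial, and the cofactor does not vanish at
    [a], because [D *m C] inherits rank [r] from the square of the symmetric matrix [A - a%:M]. *)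
Lemma mup_char_poly_sym (R : realFieldType) (n : nat) (A : 'M[R]_n) (a : R) :
  A^T = A -> (mup a (char_poly A) + \rank (A - a%:M)%R)%N = n.
Proof.
move=> As; set B := A - a%:M; set r := \rank B.
have Bs : B^T = B by rewrite /B linearB /= As tr_scalar_mx.
pose C := col_base B; pose D := row_base B.
have BE : B = C *m D by rewrite mulmx_base.
pose p := 'X - a%:P : {poly R}.
have charE : char_poly A = \det (p%:M - map_mx polyC C *m map_mx polyC D).
  rewrite /char_poly /char_poly_mx -map_mxM -BE /B map_mxB map_scalar_mx.
  by rewrite /p raddfB /= opprB addrA subrK.
pose rho := \det (p%:M - map_mx polyC D *m map_mx polyC C).
have main : p ^+ r * char_poly A = p ^+ n * rho.
  by rewrite charE det_scalar_sub_mulmxC.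
have rhoa : ~~ root rho a.
  rewrite /rho rootE -horner_evalE -det_map_mx.
  have -> : map_mx (horner_eval a)
      (p%:M - map_mx polyC D *m map_mx polyC C) = - (D *m C).
    rewrite map_mxB map_scalar_mx /= horner_evalE /p !hornerE subrr.
    rewrite raddf0 sub0r -map_mxM; congr (- _).
    by apply/matrixP => i j; rewrite !mxE /= horner_evalE hornerC.
  rewrite -unitfE -unitmxE -row_free_unit /row_free eqn_leq rank_leq_row.
  have rBB : (\rank B <= \rank (B *m B))%N.
    by have := mxrank_mul_trmx B; rewrite Bs => ->.
  rewrite mxrank_opp; apply: leq_trans rBB _.
  have -> : B *m B = (C *m D) *m (C *m D) by rewrite -BE.
  rewrite -mulmxA; apply: leq_trans (mxrankM_maxr _ _) _.
  by rewrite mulmxA; exact: mxrankM_maxl.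
have p0 : p != 0 by rewrite polyXsubC_eq0.
have ch0 : char_poly A != 0 by rewrite monic_neq0 ?char_poly_monic.
have rho0 : rho != 0 by apply: contraNneq rhoa => ->; rewrite root0.
move/(congr1 (mup a)): main.
rewrite !mupM ?expf_neq0 // !mup_XsubCX eqxx (mupNroot rhoa) addn0 addnC.
by [].
Qed.

(** * Binary shapes and their uniform growth *)

Inductive shape := Tip | Fork of shape & shape.

Fixpoint forks (t : shape) : nat :=
  if t is Fork l r then (1 + (forks l + forks r))%N else 0.

Fixpoint tips (t : shape) : nat :=
  if t is Fork l r then (tips l + tips r)%N else 1.

Fixpoint grow (t : shape) : seq shape :=
  if t is Fork l r then
    [seq Fork l' r | l' <- grow l] ++ [seq Fork l r' | r' <- grow r]
  else [:: Fork Tip Tip].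

Lemma size_grow (t : shape) : size (grow t) = (forks t).+1.
Proof.
by elim: t => //= l IHl r IHr; rewrite size_cat !size_map IHl IHr; lia.
Qed.

(* Growth histories of length [n]: a shape occurs once for each of them. *)
Fixpoint trees (n : nat) : seq shape :=
  if n is n'.+1 then flatten [seq grow t | t <- trees n'] else [:: Tip].

Section Expectation.
Variable R : realType.
Implicit Types G : shape -> R.

(** A shape with [k] forks has [k + 1] tips to grow from, so there are n! histories of length [n]
    and this is the expectation under uniform growth. *)
Definition expect (n : nat) G : R := (\sum_(t <- trees n) G t) / n`!%:R.

Lemma natr_fact_neq0 n : (n`!%:R : R) != 0.
Proof. by rewrite pnatr_eq0 -lt0n fact_gt0. Qed.

Lemma sum_grow_congr G G' t n : forks t = n ->
  (forall t, forks t = n.+1 -> G t = G' t) ->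
  \sum_(t' <- grow t) G t' = \sum_(t' <- grow t) G' t'.
Proof.
elim: t n G G' => [|l IHl r IHr] n G G' /= <- GG'.
  by rewrite !big_seq1 GG'.
rewrite !big_cat !big_map; congr (_ + _).
  by apply: (IHl _ _ _ erefl) => t tE; apply: GG'; rewrite /= tE; lia.
by apply: (IHr _ _ _ erefl) => t tE; apply: GG'; rewrite /= tE; lia.
Qed.

Lemma expect0 G : expect 0 G = G Tip.
Proof. by rewrite /expect big_seq1 fact0 divr1. Qed.

Lemma expectS n G :
  expect n.+1 G = expect n (fun t => \sum_(t' <- grow t) G t') / n.+1%:R.
Proof.
rewrite /expect /= big_flatten big_map factS natrM invfM.
by rewrite mulrA mulrAC.
Qed.

Lemma eq_expect n G G' : (forall t, forks t = n -> G t = G' t) ->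
  expect n G = expect n G'.
Proof.
elim: n G G' => [|n IH] G G' GG'; first by rewrite !expect0 GG'.
rewrite !expectS; congr (_ / _); apply: IH => t tn.
exact: sum_grow_congr tn _.
Qed.

Lemma expectD n G G' :
  expect n (fun t => G t + G' t) = expect n G + expect n G'.
Proof. by rewrite /expect big_split mulrDl. Qed.

Lemma expectZ n c G : expect n (fun t => c * G t) = c * expect n G.
Proof. by rewrite /expect -mulr_sumr mulrA. Qed.

Lemma expectB n G G' :
  expect n (fun t => G t - G' t) = expect n G - expect n G'.
Proof. by rewrite /expect sumrB mulrBl. Qed.

Lemma expect_sum n (I : Type) (s : seq I) (H : I -> shape -> R) :
  expect n (fun t => \sum_(i <- s) H i t) = \sum_(i <- s) expect n (H i).
Proof. by rewrite /expect exchange_big mulr_suml. Qed.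

Lemma expect1 n : expect n (fun=> 1) = 1.
Proof.
elim: n => [|n IH]; first by rewrite expect0.
rewrite expectS (@eq_expect _ _ (fun=> n.+1%:R * 1)).
  by rewrite expectZ IH mulr1 divff // pnatr_eq0.
by move=> t tn; rewrite mulr1 big_const_seq count_predT iter_addr addr0 size_grow tn.
Qed.

Lemma expect_cst n c : expect n (fun=> c) = c.
Proof.
by rewrite (@eq_expect _ _ (fun=> c * 1)) ?expectZ ?expect1 // => *; rewrite mulr1.
Qed.

Lemma natr_size_trees n : (size (trees n))%:R = n`!%:R :> R.
Proof.
have := expect1 n; rewrite /expect big_const_seq count_predT iter_addr addr0.
by move/(congr1 ( *%R^~ n`!%:R)); rewrite divfK ?natr_fact_neq0 // mul1r.
Qed.

Lemma expect_ge0 n G : (forall t, forks t = n -> 0 <= G t) -> 0 <= expect n G.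
Proof.
move=> G0; rewrite (@eq_expect _ _ (fun t => `|G t|)).
  by rewrite mulr_ge0 // sumr_ge0.
by move=> t /G0 /ger0_norm.
Qed.

Lemma le_expect n G G' : (forall t, forks t = n -> G t <= G' t) ->
  expect n G <= expect n G'.
Proof.
move=> GG'; rewrite -subr_ge0 -expectB; apply: expect_ge0 => t tn.
by rewrite subr_ge0 GG'.
Qed.

Lemma expect_norm_le n G c : (forall t, forks t = n -> `|G t| <= c) ->
  `|expect n G| <= c.
Proof.
move=> Gc; have Gc' t : forks t = n -> - c <= G t <= c.
  by move=> tn; rewrite -ler_norml Gc.
rewrite ler_norml -{1}(expect_cst n (- c)) -{2}(expect_cst n c).
by rewrite !le_expect // => t /Gc'/andP[].
Qed.

(** A Polya urn: with [i] forks on the left and [j] on the right, the next growth falls on the left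
    in [i + 1] cases and on the right in [j + 1]. Hence the new left size [i] is reached with weight
    [i] by growth on the left and [n.+1 - i] by growth on the right, in total [n.+1] whatever [i]
    is, and the left size stays uniform. *)
Lemma expect_split n G :
  expect n.+1 G = (\sum_(i < n.+1)
    expect i (fun l => expect (n - i) (fun r => G (Fork l r)))) / n.+1%:R.
Proof.
elim: n G => [|n IH] G.
  by rewrite expectS !expect0 big_seq1 big_ord1 !expect0.
pose g i j := expect i (fun l => expect j (fun r => G (Fork l r))).
rewrite expectS IH.
have E (i : 'I_n.+1) :
    expect i (fun l => expect (n - i)
       (fun r => \sum_(t' <- grow (Fork l r)) G t')) =
    i.+1%:R * g i.+1 (n - i)%N + (n - i).+1%:R * g i (n - i).+1.
  have n0 k : (k.+1%:R : R) != 0 by rewrite pnatr_eq0.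
  rewrite /g expectS mulrCA mulfV // mulr1 -expectZ -expectD.
  apply: eq_expect => l _; rewrite -expect_sum expectS mulrCA mulfV // mulr1.
  rewrite -expectD; apply: eq_expect => r _ /=.
  by rewrite big_cat !big_map.
rewrite (eq_bigr _ (fun i _ => E i)) big_split /=.
have -> : \sum_(i < n.+1) i.+1%:R * g i.+1 (n - i)%N =
          \sum_(i < n.+2) i%:R * g i (n.+1 - i)%N.
  rewrite [RHS]big_ord_recl mul0r add0r; apply: eq_bigr => i _.
  by rewrite lift0 subSS.
have -> : \sum_(i < n.+1) (n - i).+1%:R * g i (n - i).+1 =
          \sum_(i < n.+2) (n.+1 - i)%:R * g i (n.+1 - i)%N.
  rewrite [RHS]big_ord_recr /= subnn mul0r addr0; apply: eq_bigr => i _.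
  by rewrite subSn // -ltnS.
rewrite -big_split /= (eq_bigr (fun i : 'I_n.+2 => n.+1%:R * g i (n.+1 - i)%N)).
  by rewrite -mulr_sumr (mulrC n.+1%:R) mulfK ?pnatr_eq0.
by move=> i _; rewrite -mulrDl -natrD subnKC // -ltnS.
Qed.

End Expectation.

(** * The Gaussian distribution function and the heat equation *)

Section Gaussian.
Variable R : realType.
Implicit Types (s x y z : R).

Definition normal_cdf s x : R := fine (normal_prob 0 s `]-oo, x]%classic).
Local Notation Phi := (normal_cdf (1 : R)).
Local Notation phi := (normal_pdf 0 (1 : R)).

Lemma normal_probE s x : normal_prob 0 s `]-oo, x]%classic = (normal_cdf s x)%:E.
Proof. by rewrite fineK // fin_num_measure. Qed.

Lemma is_derive_normal_cdf s x : s != 0 ->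
  is_derive x 1 (normal_cdf s) (normal_pdf 0 s x).
Proof.
move=> s0; have xx1 : x < x + 1 by rewrite ltrDl.
have [] := @continuous_FTC1 R (normal_pdf 0 s) -oo%O x (x + 1) xx1 _ _ _.
- apply: integrableS (integrable_normal_pdf 0 s) => //.
- by rewrite ltNyr.
- exact: continuous_normal_pdf.
by move=> d <-; rewrite derive1E; exact: derivableP.
Qed.

Lemma normal_cdf_nondecreasing s x y : x <= y -> normal_cdf s x <= normal_cdf s y.
Proof.
move=> xy; apply: fine_le; rewrite ?fin_num_measure //.
by apply: le_measure; rewrite ?inE //; exact: subitvPr.
Qed.

Lemma normal_cdf_ge0 s x : 0 <= normal_cdf s x.
Proof. exact: fine_ge0. Qed.

Lemma normal_cdf_le1 s x : normal_cdf s x <= 1.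
Proof.
rewrite -lee_fin -normal_probE.
exact: (@probability_le1 _ _ _ (normal_prob 0 s)).
Qed.

(** Limits of distribution functions concern random variables; the identity is one whose law is the
    normal law itself. *)
Let idR : measurableTypeR R -> R := idfun.

#[local] HB.instance Definition _ :=
  @isMeasurableFun.Build _ _ _ _ idR (@measurable_id _ _ setT).

Lemma cvg_normal_cdfy s : (normal_cdf s x @[x --> +oo] --> (1 : R))%classic.
Proof.
apply: fine_cvg.
exact: (@cvg_cdfy1 _ _ _ (normal_prob 0 s) (idR : {mfun _ >-> _})).
Qed.

Lemma cvg_normal_cdfNy s : (normal_cdf s x @[x --> -oo] --> (0 : R))%classic.
Proof.
apply: fine_cvg.
exact: (@cvg_cdfNy0 _ _ _ (normal_prob 0 s) (idR : {mfun _ >-> _})).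
Qed.

Lemma normal_pdf1E : phi = fun z => normal_peak 1 * expR (- z ^+ 2 / 2).
Proof.
apply/funext => z; rewrite normal_pdfE ?oner_neq0 //.
by rewrite /normal_fun subr0 expr1n.
Qed.

Lemma normal_pdf_scale s x : 0 < s -> normal_pdf 0 s x = phi (x / s) * s^-1.
Proof.
move=> s0; have sN0 := lt0r_neq0 s0.
rewrite normal_pdf1E normal_pdfE // /normal_peak /normal_fun subr0 expr1n mul1r.
rewrite -mulrnAr sqrtrM ?sqr_ge0 // sqrtr_sqr gtr0_norm // invfM.
move: (Num.sqrt _) => c.
rewrite [RHS]mulrAC [c^-1 / s]mulrC; congr (_ * expR _).
by rewrite -mulr_natr; field.
Qed.

(** Both sides have the same derivative and the same limit 0 at [-oo]. *)
Lemma normal_cdf_scale s x : 0 < s -> normal_cdf s x = Phi (x / s).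
Proof.
move=> s0.
pose d (x : R) := normal_cdf s x - Phi (x / s).
have d_cst a b : d a = d b.
  apply: is_derive_0_is_cst; move=> {}x.
  have ds := is_derive_normal_cdf x (lt0r_neq0 s0).
  have n10 : (1 : R) != 0 by rewrite oner_neq0.
  have d1 := is_derive_normal_cdf (x / s) n10.
  have dV : is_derive x 1 (fun x => x / s) s^-1.
    rewrite (_ : (fun x => x / s) = s^-1 \*: id).
      by apply: is_derive_eq; rewrite scaler1.
    by apply/funext => z /=; rewrite mulrC.
  have dd : is_derive x 1 d (normal_pdf 0 s x - normal_pdf 0 1 (x / s) * s^-1).
    exact: is_deriveB.
  apply: is_derive_eq dd _.
  by rewrite normal_pdf_scale // subrr.
have dNy : (d x @[x --> -oo] --> (0 - 0 : R))%classic.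
  apply: cvgB; first exact: cvg_normal_cdfNy.
  apply: cvg_comp (@cvg_normal_cdfNy 1).
  apply: gt0_cvgMlNy; rewrite ?invr_gt0 //; exact: cvg_id.
apply/eqP; rewrite -subr_eq0; apply/eqP.
have : (d y @[y --> -oo] --> d x)%classic.
  rewrite (_ : d = cst (d x)); first exact: cvg_cst.
  by apply/funext => y; exact: d_cst.
move=> dx; have dx0 : 0 - 0 = d x := cvg_unique (@Rhausdorff R) dNy dx.
by rewrite /d in dx0; rewrite -dx0 subr0.
Qed.

End Gaussian.

(** * Differentiation rules and mean value inequalities *)

Section Derivatives.
Variable R : realType.
Implicit Types (f g : R -> R) (x y z u v a b c : R).

Lemma is_derive1_ext f g x a b : is_derive x 1 f a -> f =1 g -> a = b ->
  is_derive x 1 g b.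
Proof. by move=> fa /funext <- <-. Qed.

Lemma is_derive1D f g x a b : is_derive x 1 f a -> is_derive x 1 g b ->
  is_derive x 1 (fun y => f y + g y) (a + b).
Proof. exact: is_deriveD. Qed.

Lemma is_derive1B f g x a b : is_derive x 1 f a -> is_derive x 1 g b ->
  is_derive x 1 (fun y => f y - g y) (a - b).
Proof. exact: is_deriveB. Qed.

Lemma is_derive1M f g x a b : is_derive x 1 f a -> is_derive x 1 g b ->
  is_derive x 1 (fun y => f y * g y) (f x * b + g x * a).
Proof. exact: is_deriveM. Qed.

Lemma is_derive1_cst c x : is_derive x 1 (fun=> c) 0.
Proof. exact: is_derive_cst. Qed.

Lemma is_derive1_id x : is_derive x 1 (fun y => y) 1.
Proof. exact: is_derive_id. Qed.

Lemma is_derive1_o f g x a b : is_derive (g x) 1 f a -> is_derive x 1 g b ->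
  is_derive x 1 (fun y => f (g y)) (a * b).
Proof. exact: is_derive1_comp. Qed.

Lemma is_derive1V x : x != 0 -> is_derive x 1 (fun y => y^-1) (- x ^- 2).
Proof.
move=> x0; apply: is_derive1_ext (is_deriveV x0 (is_derive1_id x)) _ _ => //.
by rewrite /GRing.scale /= mulr1.
Qed.

Lemma ler_MVT f (df : R -> R) x y c : (forall z, x <= z <= y -> is_derive z 1 f (df z)) ->
  (forall z, x <= z <= y -> `|df z| <= c) -> x <= y ->
  `|f y - f x| <= c * (y - x).
Proof.
move=> fd fc xy.
have fd' z : z \in `]x, y[ -> is_derive z 1 f (df z).
  by rewrite in_itv /= => /andP[xz zy]; apply: fd; rewrite !ltW.
have fcont : ({within `[x, y], continuous f})%classic.
  apply: derivable_within_continuous => z.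
  by rewrite in_itv /= => xzy; have := fd z xzy.
have [z] := MVT_segment xy fd' fcont.
rewrite in_itv /= => /fc zc ->.
by rewrite normrM (ger0_norm (x := y - x)) ?subr_ge0 // ler_wpM2r ?subr_ge0.
Qed.

Lemma ler_MVT_norm f (df : R -> R) c x y :
  (forall z, is_derive z 1 f (df z)) ->
  (forall z, `|z| <= Num.max `|x| `|y| -> `|df z| <= c) ->
  `|f y - f x| <= c * `|y - x|.
Proof.
move=> fd fc.
have le z u v : u <= z <= v -> `|z| <= Num.max `|u| `|v|.
  move=> /andP[uz zv]; rewrite le_max.
  have [z0|z0] := leP 0 z.
    by rewrite (ger0_norm z0) (le_trans zv (ler_norm v)) orbT.
  have -> // : `|z| <= `|u|.
  by rewrite ltr0_norm // -(normrN u) (le_trans _ (ler_norm _)) // lerN2.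
have [xy|yx] := leP x y.
  rewrite [X in c * X]ger0_norm ?subr_ge0 //.
  apply: ler_MVT xy => // z /le; exact: fc.
rewrite distrC [X in c * X]ltr0_norm ?subr_lt0 // opprB.
apply: (@ler_MVT f df) (ltW yx) => // z /le; rewrite maxC; exact: fc.
Qed.

End Derivatives.

(** * Derivatives and Taylor estimates for the smoothed Heaviside function *)

Section Heat.
Variable R : realType.
Implicit Types (r s x y z : R).
Local Notation Phi := (normal_cdf (1 : R)).
Local Notation phi := (normal_pdf (0 : R) (1 : R)).

(* [heat r y] solves the heat equation in the time [r ^+ 2], with the Heaviside
   function as initial value; [heat1] and [heat2] are its space derivatives. *)
Definition heat r y := Phi (y / r).
Definition heat1 r y := phi (y / r) / r.
Definition heat2 r y := - (y / r) * phi (y / r) / r ^+ 2.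
Definition heat3 r y := ((y / r) ^+ 2 - 1) * phi (y / r) / r ^+ 3.
Definition heat4 r y :=
  (3 * (y / r) - (y / r) ^+ 3) * phi (y / r) / r ^+ 4.

(** The factor 8 lets [8 * (1 + z ^+ 2 / 4) ^+ 2] dominate both polynomials [z ^+ 2 - 1] and
    [3 * z - z ^+ 3] in [heat3] and [heat4]. *)
Definition heat_bound : R := 8 * normal_peak 1.

Lemma heat_bound_gt0 : 0 < heat_bound.
Proof. by rewrite mulr_gt0 // normal_peak_gt0 // oner_neq0. Qed.

Lemma is_derive_phi z : is_derive z 1 phi (- z * phi z).
Proof.
rewrite normal_pdf1E.
have d2 : is_derive z 1 (fun z => - z ^+ 2 / 2 : R) (- z).
  by apply: is_derive1_ext (is_derive1M (is_derive1_cst (- 2^-1) z)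
    (is_derive1M (is_derive1_id z) (is_derive1_id z))) _ _ => [u|] /=; field.
have de := is_derive1_o (g := fun z => - z ^+ 2 / 2) (is_derive_expR _) d2.
apply: is_derive1_ext (is_derive1M (is_derive1_cst (normal_peak 1) z) de) _ _ => //=.
by ring.
Qed.

Lemma is_derive_scale f a r y : r != 0 -> is_derive (y / r) 1 f a ->
  is_derive y 1 (fun y => f (y / r) : R) (a / r).
Proof.
move=> r0 fa; apply: (is_derive1_o (g := fun y => y / r)) fa _.
apply: is_derive1_ext (is_derive1M (is_derive1_id y) (is_derive1_cst r^-1 y)) _ _ => //=.
by ring.
Qed.

Lemma is_derive_inv_scale f a r y : r != 0 -> is_derive (y / r) 1 f a ->
  is_derive r 1 (fun r => f (y / r) : R) (- (y / r) * a / r).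
Proof.
move=> r0 fa.
have d : is_derive r 1 (fun r => y / r) (- y / r ^+ 2).
  apply: is_derive1_ext (is_derive1M (is_derive1_cst y r) (is_derive1V r0)) _ _ => //=.
  by field.
apply: is_derive1_ext (is_derive1_o (g := fun r => y / r) fa d) _ _ => //=.
by field.
Qed.

Lemma is_derive_heat r y : r != 0 -> is_derive y 1 (heat r) (heat1 r y).
Proof.
move=> r0; apply: is_derive_scale => //.
by apply: is_derive_normal_cdf; rewrite oner_neq0.
Qed.

Lemma is_derive_heat1 r y : r != 0 -> is_derive y 1 (heat1 r) (heat2 r y).
Proof.
move=> r0.
have d := is_derive_scale r0 (is_derive_phi (y / r)).
apply: is_derive1_ext (is_derive1M d (is_derive1_cst r^-1 y)) _ _ => //=.
by rewrite /heat2; field.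
Qed.

Let zphi z := - z * phi z.

Let is_derive_zphi z : is_derive z 1 zphi ((z ^+ 2 - 1) * phi z).
Proof.
apply: is_derive1_ext (is_derive1M
  (is_derive1M (is_derive1_cst (-1) z) (is_derive1_id z)) (is_derive_phi z)) _ _.
  by move=> u /=; rewrite /zphi mulN1r.
by ring.
Qed.

Lemma is_derive_heat2 r y : r != 0 -> is_derive y 1 (heat2 r) (heat3 r y).
Proof.
move=> r0.
have d := is_derive_scale r0 (is_derive_zphi (y / r)).
apply: is_derive1_ext (is_derive1M d (is_derive1_cst (r ^- 2) y)) _ _ => //=.
by rewrite /heat3; field.
Qed.

(** In the time [s = r ^+ 2] this is the heat equation with coefficient 1/2, since the derivative in
    [r] is [2 * r] times the one in [s]. *)
Lemma is_derive_heat_time r y : r != 0 ->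
  is_derive r 1 (fun r => heat r y) (r * heat2 r y).
Proof.
move=> r0.
have n10 : (1 : R) != 0 by rewrite oner_neq0.
have d := is_derive_inv_scale r0 (is_derive_normal_cdf (y / r) n10).
by apply: is_derive1_ext d _ _ => //=; rewrite /heat2; field.
Qed.

Lemma is_derive_heat2_time r y : r != 0 ->
  is_derive r 1 (fun r => heat2 r y) (r * heat4 r y).
Proof.
move=> r0.
have d := is_derive_inv_scale r0 (is_derive_zphi (y / r)).
have dV2 := is_derive1M (is_derive1V r0) (is_derive1V r0).
apply: is_derive1_ext (is_derive1M d dV2) _ _ => [u|] /=.
  by rewrite /heat2 /zphi -exprVn expr2.
by rewrite /heat4 /zphi; field.
Qed.

(** The square of [1 + t <= expR t] at [t = z ^+ 2 / 4]. *)
Lemma phi_poly_bound z : (1 + z ^+ 2 / 4) ^+ 2 * phi z <= normal_peak 1.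
Proof.
rewrite normal_pdf1E.
have p0 : 0 <= normal_peak (1 : R) by exact: normal_peak_ge0.
rewrite mulrCA ler_piMr //.
have e1 : (1 + z ^+ 2 / 4) ^+ 2 <= expR (z ^+ 2 / 2).
  rewrite (_ : z ^+ 2 / 2 = z ^+ 2 / 4 + z ^+ 2 / 4); last by field.
  rewrite expRD -expr2 lerXn2r ?nnegrE ?expR_ge0 ?expR_ge1Dx //.
  by rewrite addr_ge0 // mulr_ge0 ?sqr_ge0.
rewrite mulNr expRN; apply: le_trans (ler_wpM2r _ e1) _.
  by rewrite invr_ge0 expR_ge0.
by rewrite divff // gt_eqF ?expR_gt0.
Qed.

Lemma phi_bound (p : R) z : `|p| <= 8 * (1 + z ^+ 2 / 4) ^+ 2 ->
  `|p * phi z| <= heat_bound.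
Proof.
move=> pz; rewrite normrM (ger0_norm (normal_pdf_ge0 _ _ _)).
apply: le_trans (ler_wpM2r (normal_pdf_ge0 _ _ _) pz) _.
by rewrite -mulrA /heat_bound ler_wpM2l // phi_poly_bound.
Qed.

Lemma heat3_bound r y : 0 < r -> `|heat3 r y| <= heat_bound / r ^+ 3.
Proof.
move=> r0; have rk : 0 <= r ^- 3 by rewrite invr_ge0 exprn_ge0 // ltW.
rewrite /heat3 normrM (ger0_norm rk) ler_wpM2r // phi_bound //.
by rewrite ler_norml; apply/andP; split; nra.
Qed.

Lemma heat4_bound r y : 0 < r -> `|heat4 r y| <= heat_bound / r ^+ 4.
Proof.
move=> r0; have rk : 0 <= r ^- 4 by rewrite invr_ge0 exprn_ge0 // ltW.
rewrite /heat4 normrM (ger0_norm rk) ler_wpM2r // phi_bound //.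
move: (y / r) => z.
have z2 : 0 <= z ^+ 2 by exact: sqr_ge0.
have : `|3 * z - z ^+ 3| <= `|z| * (3 + z ^+ 2).
  rewrite (_ : 3 * z - z ^+ 3 = z * (3 - z ^+ 2)); last by ring.
  rewrite normrM ler_wpM2l // (le_trans (ler_normB _ _)) // ger0_norm //.
  by rewrite ger0_norm.
move/le_trans; apply.
have : `|z| * 2 <= 1 + z ^+ 2.
  have := sqr_ge0 (`|z| - 1); rewrite -(real_normK (num_real z)).
  by set w := `|z|; nra.
by nra.
Qed.

(** The derivatives are taken at [y] and not at [y + S], whence the term [b * S]: with [S] and [b]
    random they remain constants, and only the means of [b] and of [b * S + b ^+ 2 / 2] matter. The
    bound on [heat3] is integrated from [heat2] up to [heat]. *)
Lemma heat_space_taylor r y S b : 0 < r ->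
  `|heat r (y + (S + b)) - heat r (y + S)
    - (b * heat1 r y + (b * S + b ^+ 2 / 2) * heat2 r y)|
  <= `|b| * (`|S| + `|b|) ^+ 2 * (heat_bound / r ^+ 3).
Proof.
move=> r0; have rN0 := lt0r_neq0 r0.
set B := heat_bound / r ^+ 3.
have B0 : 0 <= B := divr_ge0 (ltW heat_bound_gt0) (exprn_ge0 _ (ltW r0)).
have dshift (f : R -> R) a x : is_derive (y + x) 1 f a ->
    is_derive x 1 (fun x => f (y + x)) a.
  move=> fa; apply: is_derive1_ext (is_derive1_o (g := fun x => y + x) fa
    (is_derive1D (is_derive1_cst y x) (is_derive1_id x))) _ _ => //.
  by rewrite add0r mulr1.
have b2 x : `|heat2 r (y + x) - heat2 r y| <= B * `|x|.
  rewrite -{2}(addr0 y) -{2}(subr0 x).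
  apply: (ler_MVT_norm (df := fun x => heat3 r (y + x))
    (f := fun x => heat2 r (y + x))) => [z|z _].
    by apply: dshift; exact: is_derive_heat2.
  exact: heat3_bound.
pose f1 x := heat1 r (y + x) - heat2 r y * x.
have df1 x : is_derive x 1 f1 (heat2 r (y + x) - heat2 r y).
  apply: is_derive1_ext (is_derive1B (dshift _ _ _ (is_derive_heat1 _ rN0))
    (is_derive1M (is_derive1_cst (heat2 r y) x) (is_derive1_id x))) _ _ => //.
  by rewrite mulr1 mulr0 addr0.
have b1 x : `|f1 x - f1 0| <= B * `|x| * `|x|.
  rewrite -{3}(subr0 x); apply: ler_MVT_norm df1 _ => z.
  rewrite normr0 (max_idPr _) // => zx; apply: le_trans (b2 z) _.
  by rewrite ler_wpM2l.
pose f0 x := heat r (y + x) - heat1 r y * x - heat2 r y / 2 * (x * x).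
have df0 x : is_derive x 1 f0 (f1 x - f1 0).
  apply: is_derive1_ext (is_derive1B (is_derive1B
    (dshift _ _ _ (is_derive_heat _ rN0))
    (is_derive1M (is_derive1_cst (heat1 r y) x) (is_derive1_id x)))
    (is_derive1M (is_derive1_cst (heat2 r y / 2) x)
      (is_derive1M (is_derive1_id x) (is_derive1_id x)))) _ _ => //.
  by rewrite /f1 addr0; field.
have : `|f0 (S + b) - f0 S| <= B * (`|S| + `|b|) ^+ 2 * `|S + b - S|.
  apply: ler_MVT_norm df0 _ => z zS; apply: le_trans (b1 z) _.
  rewrite -mulrA ler_wpM2l // -expr2 lerXn2r ?nnegrE ?addr_ge0 // (le_trans zS) //.
  by rewrite ge_max lerDl normr_ge0 ler_normD.
rewrite [S + b - S]addrC addKr.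
rewrite (_ : f0 (S + b) - f0 S = heat r (y + (S + b)) - heat r (y + S)
    - (b * heat1 r y + (b * S + b ^+ 2 / 2) * heat2 r y)); last first.
  by rewrite /f0; field.
by rewrite (_ : B * _ * _ = `|b| * (`|S| + `|b|) ^+ 2 * B) //; ring.
Qed.

(** Here too [heat2] is taken at the base time [r ^+ 2], common to all splits; over a time of length
    [H] it varies by at most [H] times the bound on [heat4]. *)
Lemma heat_time_taylor r r1 r2 H y : 0 < r -> r <= r1 -> r <= r2 ->
  r1 ^+ 2 <= r ^+ 2 + H -> r2 ^+ 2 <= r ^+ 2 + H ->
  `|heat r1 y - heat r2 y - (r1 ^+ 2 - r2 ^+ 2) / 2 * heat2 r y|
  <= `|r1 ^+ 2 - r2 ^+ 2| * H * (heat_bound / r ^+ 4).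
Proof.
move=> r0.
wlog r12 : r1 r2 / r2 <= r1 => [IH|] rr1 rr2 H1 H2.
  have [r12|r12] := leP r2 r1; first exact: IH.
  have := IH r2 r1 (ltW r12) rr2 rr1 H2 H1.
  rewrite (distrC (r2 ^+ 2)) => IH12; rewrite -normrN.
  by rewrite [X in `|X| <= _](_ : _ = heat r2 y - heat r1 y
    - (r2 ^+ 2 - r1 ^+ 2) / 2 * heat2 r y) //; ring.
set B := heat_bound / r ^+ 4.
have B0 : 0 <= B := divr_ge0 (ltW heat_bound_gt0) (exprn_ge0 _ (ltW r0)).
pose g t := heat t y - t * t / 2 * heat2 r y.
have dg t : r2 <= t <= r1 -> is_derive t 1 g (t * (heat2 t y - heat2 r y)).
  move=> /andP[r2t _]; have t0 : t != 0.
    by rewrite gt_eqF // (lt_le_trans r0) // (le_trans rr2).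
  apply: is_derive1_ext (is_derive1B (is_derive_heat_time y t0)
    (is_derive1M (is_derive1M (is_derive1_id t) (is_derive1_id t))
      (is_derive1_cst (heat2 r y / 2) t))) _ _ => [u|] /=.
    by rewrite /g; ring.
  by field.
have b2 t : r <= t -> `|heat2 t y - heat2 r y| <= t * B * (t - r).
  move=> rt; apply: (@ler_MVT _ (fun t => heat2 t y) (fun t => t * heat4 t y)) => //.
    move=> u /andP[ru _]; apply: is_derive_heat2_time.
    by rewrite gt_eqF // (lt_le_trans r0).
  move=> u /andP[ru ut]; have u0 : 0 < u by exact: lt_le_trans ru.
  rewrite normrM (gtr0_norm u0); apply: ler_pM => //; first exact: ltW.
  apply: le_trans (heat4_bound _ u0) _.
  rewrite /B ler_wpM2l ?(ltW heat_bound_gt0) // lef_pV2 ?posrE ?exprn_gt0 //.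
  by rewrite lerXn2r // nnegrE ltW.
have b1 t : r2 <= t <= r1 -> `|t * (heat2 t y - heat2 r y)| <= r1 * (H * B).
  move=> /andP[r2t tr1]; have rt : r <= t by exact: le_trans r2t.
  have t0 : 0 < t by exact: lt_le_trans rt.
  rewrite normrM gtr0_norm //; apply: ler_pM => //; first exact: ltW.
  apply: le_trans (b2 t rt) _; rewrite mulrAC ler_wpM2r //.
  have : t ^+ 2 <= r1 ^+ 2 by rewrite lerXn2r ?nnegrE ?(le_trans (ltW t0)).
  by nra.
have := ler_MVT dg b1 r12.
rewrite (_ : g r1 - g r2 = heat r1 y - heat r2 y
  - (r1 ^+ 2 - r2 ^+ 2) / 2 * heat2 r y); last by rewrite /g; field.
move/le_trans; apply; rewrite (ger0_norm (x := r1 ^+ 2 - r2 ^+ 2)); last first.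
  by rewrite subr_ge0 lerXn2r ?nnegrE ?(le_trans (ltW r0)).
have HB0 : 0 <= H * B.
  rewrite mulr_ge0 //; have : r ^+ 2 <= r1 ^+ 2.
    by rewrite lerXn2r ?nnegrE ?(le_trans (ltW r0)).
  by lra.
have r20 : 0 <= r2 by rewrite (le_trans (ltW r0)).
have := mulr_ge0 HB0 (mulr_ge0 r20 (_ : 0 <= r1 - r2)).
by rewrite subr_ge0 => /(_ r12); lra.
Qed.

End Heat.

(** * The central limit theorem for additive functionals *)

Section Recurrence.
Variable R : realType.
Implicit Types (x tau rho : nat -> R) (n k : nat).

Definition weighted_sum tau n : R :=
  \sum_(k < n) 2 * tau k / (k.+1%:R * k.+2%:R).

(** The partial sums of [x], divided by [n.+1 * n.+2 / 2], telescope with increments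
    [2 * tau k / (k.+1 * k.+2)]. *)
Lemma quicksort_recurrence x tau : x 0%N = tau 0%N ->
  (forall n, x n.+1 = 2 / n.+1%:R * (\sum_(i < n.+1) x i) + tau n.+1) ->
  forall n, x n = n.+1%:R * weighted_sum tau n + tau n.
Proof.
move=> x0 xS.
have n0 n : n.+1%:R != 0 :> R by rewrite pnatr_eq0.
suff S n : \sum_(i < n.+1) x i = n.+1%:R * n.+2%:R / 2 * weighted_sum tau n.+1.
  case=> [|n]; first by rewrite x0 /weighted_sum big_ord0 mulr0 add0r.
  by rewrite xS S; field.
have wS m : weighted_sum tau m.+1 =
    weighted_sum tau m + 2 * tau m / (m.+1%:R * m.+2%:R).
  by rewrite /weighted_sum big_ord_recr.
elim: n => [|n IH].
  by rewrite big_ord1 x0 wS /weighted_sum big_ord0; field.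
rewrite big_ord_recr /= xS IH [in RHS]wS.
have e2 : n.+2%:R = n.+1%:R + 1 :> R by rewrite natr1.
have e3 : n.+3%:R = n.+1%:R + 2 :> R by rewrite -natrD addn2.
move: (n0 n) (n0 n.+1) (n0 n.+2); rewrite e3 e2.
by move: n.+1%:R (weighted_sum _ _) (tau _) => N W t N0 N1 N2; field; rewrite N2 N1 N0.
Qed.

(* The bounds [w n - rho n] increase and the bounds [w n + rho n] decrease,
   [w] being the weighted sum. *)
Lemma weighted_sum_limit tau rho : (forall n, 0 <= rho n) ->
  (forall k, `|2 * tau k / (k.+1%:R * k.+2%:R)| <= rho k - rho k.+1) ->
  exists L, forall n, `|weighted_sum tau n - L| <= rho n.
Proof.
move=> rho0 tau_rho; set w := weighted_sum tau.
have step k : `|w k.+1 - w k| <= rho k - rho k.+1.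
  by rewrite /w /weighted_sum big_ord_recr /= [_ + _ - _]addrC addKr.
have lo n m : (n <= m)%N -> w n - rho n <= w m - rho m.
  move=> /subnK <-; elim: (m - n)%N => //= k /le_trans-> //.
  by move: (step (k + n)%N); rewrite ler_norml addSn => /andP[]; lra.
have hi n m : (n <= m)%N -> w m + rho m <= w n + rho n.
  move=> /subnK <-; elim: (m - n)%N => //= k; apply: le_trans.
  by move: (step (k + n)%N); rewrite ler_norml addSn => /andP[]; lra.
have lohi n m : w n - rho n <= w m + rho m.
  have h1 := lo _ _ (leq_maxl n m); have h2 := hi _ _ (leq_maxr n m).
  by have := rho0 (maxn n m); lra.
pose E := range (fun n => w n - rho n).
have E0 : (E !=set0)%classic by exists (w 0%N - rho 0%N); exists 0%N.
have ubE m : ubound E (w m + rho m) by move=> _ [n _ <-].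
exists (sup E) => n; rewrite ler_norml; apply/andP; split.
  have : sup E <= w n + rho n by apply: ge_sup.
  by lra.
have : w n - rho n <= sup E.
  by apply: ub_le_sup; [exists (w 0%N + rho 0%N)|exists n].
by lra.
Qed.

Lemma weighted_sum_limit_bounded tau c : (forall k, `|tau k| <= c) ->
  exists L, forall n, `|weighted_sum tau n - L| <= 2 * c / n.+1%:R.
Proof.
move=> tc; have c0 : 0 <= c := le_trans (normr_ge0 _) (tc 0%N).
apply: weighted_sum_limit => [n|k]; first by rewrite divr_ge0 // mulr_ge0.
have k1 : 0 < k.+1%:R :> R by rewrite ltr0n.
have k2 : 0 < k.+2%:R :> R by rewrite ltr0n.
rewrite !normrM normfV (gtr0_norm (mulr_gt0 k1 k2)) (gtr0_norm (ltr0n _ 2)).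
rewrite [leRHS](_ : _ = 2 * c / (k.+1%:R * k.+2%:R)).
  by rewrite ler_wpM2r ?ler_wpM2l // invr_ge0 mulr_ge0 // ltW.
have e2 : k.+2%:R = k.+1%:R + 1 :> R by rewrite natr1.
move: (lt0r_neq0 k1) (lt0r_neq0 k2); rewrite e2.
by move: (k.+1%:R) => N N0 N1; field; rewrite N0 N1.
Qed.

Lemma weighted_sum_sqrt_bound tau c k : `|tau k| <= c * Num.sqrt k.+1%:R ->
  `|2 * tau k / (k.+1%:R * k.+2%:R)| <=
  4 * c / Num.sqrt k.+1%:R - 4 * c / Num.sqrt k.+2%:R.
Proof.
move=> tc.
have k1 : 0 < k.+1%:R :> R by rewrite ltr0n.
have k2 : 0 < k.+2%:R :> R by rewrite ltr0n.
rewrite !normrM normfV (gtr0_norm (mulr_gt0 k1 k2)) (gtr0_norm (ltr0n _ 2)).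
have a0 : 0 < Num.sqrt k.+1%:R :> R by rewrite sqrtr_gt0.
have b0 : 0 < Num.sqrt k.+2%:R :> R by rewrite sqrtr_gt0.
have ab : Num.sqrt k.+1%:R <= Num.sqrt k.+2%:R :> R.
  by rewrite ler_sqrt ?ler_nat // ltW.
have c0 : 0 <= c by rewrite -(pmulr_lge0 _ a0) (le_trans _ tc).
have aE : k.+1%:R = Num.sqrt k.+1%:R ^+ 2 :> R by rewrite sqr_sqrtr // ltW.
have bE : k.+2%:R = Num.sqrt k.+2%:R ^+ 2 :> R by rewrite sqr_sqrtr // ltW.
have ba : Num.sqrt k.+2%:R ^+ 2 = Num.sqrt k.+1%:R ^+ 2 + 1 :> R.
  by rewrite -aE -bE natr1.
rewrite [X in _ / (X * _)]aE [X in _ / (_ * X)]bE.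
move: (Num.sqrt k.+1%:R) (Num.sqrt k.+2%:R) tc a0 b0 ab ba => a b tc a0 b0 ab ba.
rewrite (_ : 4 * c / a - 4 * c / b = 4 * c * (b - a) / (a * b)); last first.
  by field; rewrite !gt_eqF.
rewrite ler_pdivrMr ?mulr_gt0 ?exprn_gt0 //.
rewrite [leRHS](_ : _ = 4 * c * a * ((b - a) * b)); last by field; rewrite !gt_eqF.
apply: (le_trans (ler_wpM2l _ tc)) => //.
(* Here [(b - a) * (b + a) = 1] and [b + a <= 2 * b]. *)
have h : 2^-1 <= (b - a) * b by nra.
have := ler_wpM2l (mulr_ge0 (mulr_ge0 (ler0n R 4) c0) (ltW a0)) h.
by lra.
Qed.

Lemma weighted_sum_limit_sqrt tau c :
  (forall k, `|tau k| <= c * Num.sqrt k.+1%:R) ->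
  exists L, forall n, `|weighted_sum tau n - L| <= 4 * c / Num.sqrt n.+1%:R.
Proof.
move=> tc; apply: weighted_sum_limit => [n|k]; last exact: weighted_sum_sqrt_bound.
rewrite divr_ge0 ?sqrtr_ge0 // mulr_ge0 //.
by have := le_trans (normr_ge0 _) (tc 0%N); rewrite sqrtr1 mulr1.
Qed.

(** Only the tolls before [n] are constrained, so that this can be used inside a strong induction on
    [n], when larger tolls are not yet under control. *)
Lemma weighted_sum_le tau c n :
  (forall k, (k < n)%N -> `|tau k| <= c * Num.sqrt k.+1%:R) ->
  0 <= c -> `|weighted_sum tau n| <= 4 * c.
Proof.
move=> tc c0.
suff : `|weighted_sum tau n| <= 4 * c - 4 * c / Num.sqrt n.+1%:R.
  move/le_trans; apply; rewrite lerBlDr lerDl.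
  by rewrite divr_ge0 ?sqrtr_ge0 // mulr_ge0.
elim: n tc => [|n IH] tc.
  by rewrite /weighted_sum big_ord0 normr0 sqrtr1 divr1 subrr.
rewrite /weighted_sum big_ord_recr /= (le_trans (ler_normD _ _)) //.
have h := weighted_sum_sqrt_bound (tc n (ltnSn n)).
apply: le_trans (lerD (IH _) h) _; last by lra.
by move=> k kn; apply: tc; rewrite ltnS ltnW.
Qed.

End Recurrence.

(** * Averages over the two subtrees of a fork *)

Section Average.
Variable R : realType.
Implicit Types (K : nat -> nat -> R) (H : shape -> shape -> R) (n i j : nat).

Definition average n K : R := (\sum_(i < n.+1) K i (n - i)%N) / n.+1%:R.

Definition expect2 H i j : R := expect i (fun l => expect j (fun r => H l r)).

Lemma expect_fork n (G : shape -> R) :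
  expect n.+1 G = average n (expect2 (fun l r => G (Fork l r))).
Proof. exact: expect_split. Qed.

Lemma averageD n K K' :
  average n (fun i j => K i j + K' i j) = average n K + average n K'.
Proof. by rewrite /average big_split mulrDl. Qed.

Lemma averageZ n c K : average n (fun i j => c * K i j) = c * average n K.
Proof. by rewrite /average -mulr_sumr mulrA. Qed.

Lemma averageB n K K' :
  average n (fun i j => K i j - K' i j) = average n K - average n K'.
Proof. by rewrite /average sumrB mulrBl. Qed.

Lemma le_average n K K' : (forall i j, (i + j)%N = n -> K i j <= K' i j) ->
  average n K <= average n K'.
Proof.
move=> KK'; rewrite ler_wpM2r ?invr_ge0 // ler_sum // => i _.
by rewrite KK' // subnKC // -ltnS.
Qed.

Lemma eq_average n K K' : (forall i j, (i + j)%N = n -> K i j = K' i j) ->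
  average n K = average n K'.
Proof.
by move=> KK'; apply/le_anti; rewrite !le_average // => i j /KK' ->.
Qed.

Lemma average_cst n c : average n (fun _ _ => c) = c.
Proof.
by rewrite /average sumr_const card_ord -(mulr_natr c) mulfK // pnatr_eq0.
Qed.

Lemma average_diag n (f : nat -> R) :
  average n (fun i j => f i + f j) = 2 / n.+1%:R * \sum_(i < n.+1) f i.
Proof.
rewrite /average big_split /= [X in _ + X](_ : _ = \sum_(i < n.+1) f i).
  by rewrite [RHS]mulrAC mulr_natl mulr2n.
by rewrite (reindex_inj rev_ord_inj); apply: eq_bigr => i _ /=; rewrite subKn // -ltnS.
Qed.

Lemma average_norm_le n K c : (forall i j, (i + j)%N = n -> `|K i j| <= c) ->
  `|average n K| <= c.
Proof.
move=> Kc; rewrite ler_norml -{1}(average_cst n (- c)) -{2}(average_cst n c).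
by rewrite !le_average // => i j /Kc; rewrite ler_norml => /andP[].
Qed.

Lemma expect2D H H' i j :
  expect2 (fun l r => H l r + H' l r) i j = expect2 H i j + expect2 H' i j.
Proof. by rewrite -expectD; apply: eq_expect => l _; rewrite expectD. Qed.

Lemma expect2Z c H i j : expect2 (fun l r => c * H l r) i j = c * expect2 H i j.
Proof. by rewrite -expectZ; apply: eq_expect => l _; rewrite expectZ. Qed.

Lemma expect2B H H' i j :
  expect2 (fun l r => H l r - H' l r) i j = expect2 H i j - expect2 H' i j.
Proof. by rewrite -expectB; apply: eq_expect => l _; rewrite expectB. Qed.

Lemma expect2M (f g : shape -> R) i j :
  expect2 (fun l r => f l * g r) i j = expect i f * expect j g.
Proof.
rewrite mulrC -expectZ; apply: eq_expect => l _.
by rewrite expectZ mulrC.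
Qed.

Lemma expect2l (f : shape -> R) i j : expect2 (fun l _ => f l) i j = expect i f.
Proof. by apply: eq_expect => l _; rewrite expect_cst. Qed.

Lemma expect2r (f : shape -> R) i j : expect2 (fun _ r => f r) i j = expect j f.
Proof. exact: expect_cst. Qed.

Lemma expect2_cst c i j : expect2 (fun _ _ => c) i j = c.
Proof. by rewrite expect2l expect_cst. Qed.

Lemma le_expect2 H H' i j :
  (forall l r, forks l = i -> forks r = j -> H l r <= H' l r) ->
  expect2 H i j <= expect2 H' i j.
Proof. by move=> HH'; apply: le_expect => l li; apply: le_expect => r; exact: HH'. Qed.

Lemma eq_expect2 H H' i j :
  (forall l r, forks l = i -> forks r = j -> H l r = H' l r) ->
  expect2 H i j = expect2 H' i j.
Proof. by move=> HH'; apply: eq_expect => l li; apply: eq_expect => r; exact: HH'. Qed.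

Lemma expect2_norm_le H H' i j :
  (forall l r, forks l = i -> forks r = j -> `|H l r| <= H' l r) ->
  `|expect2 H i j| <= expect2 H' i j.
Proof.
move=> HH'; rewrite ler_norml -mulN1r -expect2Z !le_expect2 // => l r li rj.
  by have := HH' _ _ li rj; rewrite ler_norml => /andP[].
by have := HH' _ _ li rj; rewrite mulN1r ler_norml => /andP[].
Qed.

End Average.

(** * Mean and variance of an additive functional *)

Section AdditiveFunctional.
Variables (R : realType) (F : shape -> R) (C : R).
Hypothesis C_gt0 : 0 < C.
Hypothesis F_Tip : `|F Tip| <= C.
Hypothesis F_Fork : forall l r, `|F (Fork l r) - F l - F r| <= C.

Definition mean n := expect n F.
Definition centered t := F t - mean (forks t).
Definition variance n := expect n (fun t => centered t ^+ 2).
Definition toll l r := centered (Fork l r) - centered l - centered r.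

Lemma centered_Fork l r : centered (Fork l r) = centered l + centered r + toll l r.
Proof. by rewrite /toll; ring. Qed.

Lemma expect_centered n : expect n centered = 0.
Proof.
rewrite (@eq_expect _ _ _ (fun t => F t - mean n)) => [|t <-] //.
by rewrite expectB expect_cst subrr.
Qed.

Lemma variance_ge0 n : 0 <= variance n.
Proof. by apply: expect_ge0 => t _; exact: sqr_ge0. Qed.

Let mean_toll n : R :=
  if n is n'.+1 then average n' (expect2 (fun l r => F (Fork l r) - F l - F r))
  else F Tip.

Let mean_toll_le n : `|mean_toll n| <= C.
Proof.
case: n => [|n] /=; first exact: F_Tip.
apply: average_norm_le => i j _; rewrite -[leRHS](@expect2_cst R _ i j).
exact: expect2_norm_le.
Qed.

Let meanE n : mean n = n.+1%:R * weighted_sum mean_toll n + mean_toll n.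
Proof.
apply: quicksort_recurrence => [|{}n]; first exact: expect0.
rewrite -average_diag -averageD /mean expect_fork; apply: eq_average => i j _.
rewrite -(expect2l (R := R) F i j) -(expect2r (R := R) F i j) -!expect2D.
by apply: eq_expect2 => l r _ _; ring.
Qed.

Lemma mean_asymptotics :
  exists mu, forall n, `|mean n - mu * n.+1%:R| <= 3 * C.
Proof.
have [mu muP] := weighted_sum_limit_bounded mean_toll_le.
exists mu => n; rewrite meanE.
have n0 : 0 < n.+1%:R :> R by rewrite ltr0n.
have h : `|(weighted_sum mean_toll n - mu) * n.+1%:R| <= 2 * C.
  by rewrite normrM (gtr0_norm n0) -ler_pdivlMr.
rewrite [X in `|X|](_ : _ = (weighted_sum mean_toll n - mu) * n.+1%:R + mean_toll n).
  apply: le_trans (ler_normD _ _) (le_trans (lerD h (mean_toll_le n)) _).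
  by lra.
by ring.
Qed.

(** [D] bounds the centered toll. A variance bound [K ^+ 2 * n.+1] yields a variance toll of at most
    [2 * D * K + D ^+ 2 = W] times a square root, and this returns a variance of at most
    [5 * W = 115 * D ^+ 2] per tip. The induction closes because [K ^+ 2 = 121 * D ^+ 2]. *)
Let D := 10 * C.
Let K := 11 * D.
Let W := 23 * D ^+ 2.

Let D_gt0 : 0 < D. Proof. exact: mulr_gt0. Qed.

(** The number of tips, forks plus one, is additive over a fork, so the linear parts of the three
    means cancel. What remains is [C] from the toll of [F] and [3 * C] from each mean. *)
Lemma toll_le l r : `|toll l r| <= 10 * C.
Proof.
have [mu muP] := mean_asymptotics.
have := F_Fork l r; rewrite /toll /centered /=.
have := muP (forks l); have := muP (forks r); have := muP (1 + (forks l + forks r))%N.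
rewrite -!natr1 !natrD !ler_norml => /andP[? ?] /andP[? ?] /andP[? ?] /andP[? ?].
by apply/andP; split; lra.
Qed.

Lemma average_toll n : average n (expect2 toll) = 0.
Proof.
have := expect_centered n.+1; rewrite expect_fork => E; rewrite -[RHS]E.
apply: eq_average => i j _.
rewrite [RHS](@eq_expect2 _ _ (fun l r => (centered l + centered r) + toll l r)).
  by rewrite [RHS]expect2D [X in _ = X + _]expect2D expect2l expect2r !expect_centered !add0r.
by move=> l r _ _; exact: centered_Fork.
Qed.

Lemma expect2_sqr_centered i j :
  expect2 (fun l r => (centered l + centered r) ^+ 2) i j = variance i + variance j.
Proof.
rewrite (@eq_expect2 _ _ (fun l r => centered l ^+ 2 + centered r ^+ 2
  + 2 * (centered l * centered r))); last by move=> l r _ _; ring.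
rewrite !expect2D expect2Z expect2M !expect_centered mul0r mulr0 addr0.
by rewrite (expect2l (fun l => centered l ^+ 2)) (expect2r (fun r => centered r ^+ 2)).
Qed.

Definition variance_toll n : R :=
  if n is n'.+1 then
    average n' (expect2 (fun l r => 2 * toll l r * (centered l + centered r)
                                    + toll l r ^+ 2))
  else 0.

Lemma varianceS n :
  variance n.+1 = 2 / n.+1%:R * (\sum_(i < n.+1) variance i) + variance_toll n.+1.
Proof.
rewrite -average_diag -averageD /variance expect_fork; apply: eq_average => i j _.
rewrite -/(variance i) -/(variance j) -expect2_sqr_centered -expect2D.
by apply: eq_expect2 => l r _ _; rewrite centered_Fork; ring.
Qed.

Lemma variance0 : variance 0 = 0.
Proof. by rewrite /variance expect0 /centered /mean expect0 subrr expr0n. Qed.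

Let varianceE n :
  variance n = n.+1%:R * weighted_sum variance_toll n + variance_toll n.
Proof. by apply: quicksort_recurrence; [exact: variance0|exact: varianceS]. Qed.

(** The cross term of toll and parts is split by the inequality of means with weight [K * s], the
    weight that balances its two halves when the second moment of the sum of the parts is at most
    [(K * s) ^+ 2]. *)
Let variance_toll_le n :
  (forall i, (i < n)%N -> variance i <= K ^+ 2 * i.+1%:R) ->
  `|variance_toll n| <= W * Num.sqrt n.+1%:R.
Proof.
case: n => [_|n varK] /=.
  by rewrite normr0 sqrtr1 mulr1 /W mulr_ge0 // sqr_ge0.
apply: average_norm_le => i j ij.
set s := Num.sqrt n.+2%:R.
have s1 : 1 <= s by rewrite -(@sqrtr1 R) ler_sqrt ?ltr0n // ler1n.
have K0 : 0 < K by rewrite /K mulr_gt0.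
have Ks0 : 0 < K * s by rewrite mulr_gt0 // (lt_le_trans ltr01).
pose H l r := D / (K * s) * (centered l + centered r) ^+ 2 + (D * (K * s) + D ^+ 2).
apply: le_trans (_ : expect2 H i j <= _).
  apply: expect2_norm_le => l r _ _; rewrite /H.
  have := toll_le l r; rewrite -/D; move: (toll l r) (centered l + centered r) => b S bD.
  have amgm : 2 * `|S| <= S ^+ 2 / (K * s) + K * s.
    move: (K * s) Ks0 => q q0.
    have E : S ^+ 2 / q + q - 2 * `|S| = (`|S| - q) ^+ 2 / q.
      by rewrite -(real_normK (num_real S)); field; rewrite gt_eqF.
    rewrite -subr_ge0 E; exact: divr_ge0 (sqr_ge0 _) (ltW q0).
  apply: le_trans (ler_normD _ _) _; rewrite addrA lerD //; last first.
    by rewrite normrX lerXn2r // nnegrE ltW.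
  have amgm2 : `|2 * S| <= S ^+ 2 / (K * s) + K * s by rewrite normrM ger0_norm.
  rewrite -mulrA mulrCA normrM.
  apply: le_trans (ler_pM (normr_ge0 _) (normr_ge0 _) bD amgm2) _.
  by rewrite mulrDr lerD2r [X in X <= _]mulrA mulrAC.
rewrite /H expect2D expect2Z expect2_cst expect2_sqr_centered.
have vij : variance i + variance j <= K ^+ 2 * s ^+ 2.
  rewrite /s sqr_sqrtr // (_ : n.+2%:R = i.+1%:R + j.+1%:R :> R).
    by rewrite mulrDr lerD // varK //; lia.
  by rewrite -natrD; congr _%:R; lia.
have DKs : 0 <= D / (K * s) by rewrite divr_ge0 // ltW.
have := ler_wpM2l DKs vij.
rewrite (_ : D / (K * s) * (K ^+ 2 * s ^+ 2) = D * (K * s)); last first.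
  by field; rewrite !gt_eqF // (lt_le_trans ltr01).
move=> h; apply: le_trans (lerD h (lexx _)) _.
rewrite /W /K; have := ler_wpM2l (sqr_ge0 D) s1; lra.
Qed.

Let varianceK n : variance n <= K ^+ 2 * n.+1%:R.
Proof.
have [k] := ubnP n; elim: k n => // k IH n /ltnSE nk.
have tollW m : (m <= n)%N -> `|variance_toll m| <= W * Num.sqrt m.+1%:R.
  move=> mn; apply: variance_toll_le => i im; apply: IH.
  exact: leq_trans im (leq_trans mn nk).
have W0 : 0 <= W := mulr_ge0 (ler0n _ _) (sqr_ge0 _).
have hw : `|weighted_sum variance_toll n| <= 4 * W.
  by apply: weighted_sum_le => // m /ltnW; exact: tollW.
have := tollW n (leqnn n).
have n1 : 1 <= n.+1%:R :> R by rewrite ler1n.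
have sn : Num.sqrt n.+1%:R <= n.+1%:R :> R.
  rewrite -{2}(sqr_sqrtr (ler0n R n.+1)) expr2 ler_peMl ?sqrtr_ge0 //.
  by rewrite -[X in X <= _](@sqrtr1 R) ler_sqrt ?ltr0n.
move=> /(le_trans (ler_norm _)) ht; rewrite varianceE.
have := ler_wpM2l (le_trans ler01 n1) (le_trans (ler_norm _) hw).
have := ler_wpM2l W0 sn.
have : 0 <= D ^+ 2 * n.+1%:R by rewrite mulr_ge0 ?sqr_ge0.
by rewrite /K; move: ht; rewrite /W; lra.
Qed.

Lemma variance_le : exists k, 0 < k /\ forall n, variance n <= k * n.+1%:R.
Proof. by exists (K ^+ 2); split => //; rewrite exprn_gt0 // mulr_gt0. Qed.

Lemma variance_asymptotics : exists sigma2 w, [/\ 0 <= sigma2, 0 <= w &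
  forall n, `|variance n - sigma2 * n.+1%:R| <= w * Num.sqrt n.+1%:R].
Proof.
have tollW n : `|variance_toll n| <= W * Num.sqrt n.+1%:R.
  by apply: variance_toll_le => i _; exact: varianceK.
have W0 : 0 <= W := mulr_ge0 (ler0n _ _) (sqr_ge0 _).
have [sigma2 sP] := weighted_sum_limit_sqrt tollW.
have main n : `|variance n - sigma2 * n.+1%:R| <= 5 * W * Num.sqrt n.+1%:R.
  rewrite varianceE.
  have n0 : 0 < n.+1%:R :> R by rewrite ltr0n.
  have s0 : 0 < Num.sqrt n.+1%:R :> R by rewrite sqrtr_gt0.
  have h : `|(weighted_sum variance_toll n - sigma2) * n.+1%:R|
      <= 4 * W / Num.sqrt n.+1%:R * n.+1%:R.
    by rewrite normrM (gtr0_norm n0) ler_pM2r.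
  rewrite [X in `|X|](_ : _ =
    (weighted_sum variance_toll n - sigma2) * n.+1%:R + variance_toll n); last by ring.
  apply: le_trans (ler_normD _ _) (le_trans (lerD h (tollW n)) _).
  rewrite -[X in _ / _ * X + _](sqr_sqrtr (ltW n0)).
  rewrite (_ : 4 * W / _ * _ = 4 * W * Num.sqrt n.+1%:R); first by lra.
  by field; rewrite gt_eqF.
exists sigma2, (5 * W); split=> //; last by rewrite mulr_ge0.
(* With a negative [sigma2], the linear term would outweigh the error from size [m] on and make the
   variance negative. *)
rewrite leNgt; apply/negP => s2.
pose m := Num.bound ((5 * W / sigma2) ^+ 2).
have m0 : (5 * W / sigma2) ^+ 2 < m.+1%:R.
  apply: lt_trans (_ : m%:R < _); last by rewrite ltr_nat.
  by rewrite /m archi_boundP ?sqr_ge0.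
have := main m; have := variance_ge0 m.
have mE : m.+1%:R = Num.sqrt m.+1%:R ^+ 2 :> R by rewrite sqr_sqrtr.
have s0 : 0 < Num.sqrt m.+1%:R :> R by rewrite sqrtr_gt0.
move: m0; rewrite [X in sigma2 * X]mE [X in _ < X]mE.
move: (Num.sqrt m.+1%:R) s0 => s s0.
rewrite -ltr_sqrt ?exprn_gt0 // !sqrtr_sqr (gtr0_norm s0).
rewrite normrM normfV (ltr0_norm s2) (ger0_norm (mulr_ge0 (ler0n R 5) W0)).
rewrite ltr_pdivrMr ?oppr_gt0 // -(ltr_pM2l s0).
move: (5 * W) (variance m) => w v h v0; rewrite ler_norml => /andP[_ h'].
by lra.
Qed.

End AdditiveFunctional.

(** * Comparison with a Gaussian of the same variance *)

Section HeatComparison.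
Variables (R : realType) (F : shape -> R) (C : R).
Hypothesis C_gt0 : 0 < C.
Hypothesis F_Tip : `|F Tip| <= C.
Hypothesis F_Fork : forall l r, `|F (Fork l r) - F l - F r| <= C.

Local Notation X := (centered F).
Local Notation v := (variance F).
Local Notation b := (toll F).

(* The solution of the quicksort recurrence with toll [A * n.+1] and no
   initial value. *)
Definition comparison_error (A : R) n : R :=
  n.+1%:R * \sum_(k < n) 2 * A / k.+2%:R.

Lemma comparison_error_ge0 A n : 0 <= A -> 0 <= comparison_error A n.
Proof.
move=> A0; rewrite mulr_ge0 // sumr_ge0 // => i _.
by rewrite divr_ge0 // mulr_ge0.
Qed.

Lemma comparison_errorS A n :
  average n (fun i j => comparison_error A i + comparison_error A j) + A * n.+2%:R
  = comparison_error A n.+1.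
Proof.
rewrite average_diag.
have n0 m : m.+1%:R != 0 :> R by rewrite pnatr_eq0.
suff -> : \sum_(i < n.+1) comparison_error A i =
    n.+1%:R / 2 * (comparison_error A n.+1 - A * n.+2%:R).
  move: (n0 n) (comparison_error A n.+1) (A * n.+2%:R).
  by move: (n.+1%:R) => N N0 e q; field.
elim: n => [|n IH].
  by rewrite big_ord1 /comparison_error big_ord0 big_ord1 /=; field.
rewrite big_ord_recr /= IH /comparison_error [in RHS]big_ord_recr /=.
have e2 : n.+2%:R = n.+1%:R + 1 :> R by rewrite natr1.
have e3 : n.+3%:R = n.+1%:R + 2 :> R by rewrite -natrD addn2.
move: (n0 n.+2); rewrite e3 e2.
by move: (\sum_(i < n.+1) _) (n.+1%:R) => s N N0; field.
Qed.

(** A fourth root in place of the logarithm: with [p ^+ 4 = q ^+ 4 + 1], factoring [p ^+ 4 - q ^+ 4]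
    gives [1 <= 4 * (p - q) * p ^+ 3]. Any power below 1/2 would do, as the error is later divided
    by a multiple of the power 3/2 of [n.+1]. *)
Lemma comparison_error_le A n : 0 <= A ->
  comparison_error A n <= 8 * A * n.+1%:R * Num.sqrt (Num.sqrt n.+1%:R).
Proof.
move=> A0; rewrite /comparison_error (mulrC (8 * A)) -[leRHS]mulrA ler_wpM2l //.
elim: n => [|n IH].
  by rewrite big_ord0 !mulr_ge0 ?sqrtr_ge0.
rewrite big_ord_recr /=; apply: le_trans (lerD IH (lexx _)) _.
have q0 : 0 < Num.sqrt (Num.sqrt n.+1%:R) :> R by rewrite !sqrtr_gt0.
have p1 : 1 <= Num.sqrt (Num.sqrt n.+2%:R) :> R.
  rewrite -[X in X <= _](@sqrtr1 R) ler_sqrt ?sqrtr_gt0 //.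
  by rewrite -[X in X <= _](@sqrtr1 R) ler_sqrt ?ltr0n // ler1n.
have q4 : Num.sqrt (Num.sqrt n.+1%:R) ^+ 4 = n.+1%:R :> R.
  by rewrite (exprM _ 2 2) !sqr_sqrtr ?sqrtr_ge0.
have p4 : Num.sqrt (Num.sqrt n.+2%:R) ^+ 4 = n.+2%:R :> R.
  by rewrite (exprM _ 2 2) !sqr_sqrtr ?sqrtr_ge0.
have p4q4 : Num.sqrt (Num.sqrt n.+2%:R) ^+ 4
    = Num.sqrt (Num.sqrt n.+1%:R) ^+ 4 + 1 :> R by rewrite p4 q4 natr1.
rewrite -[X in 2 * A / X]p4; move: p1 p4q4 q0 {p4 q4 IH}.
move: (Num.sqrt (Num.sqrt n.+2%:R)) (Num.sqrt (Num.sqrt n.+1%:R)) => p q p1 pq q0.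
have p0 : 0 < p by lra.
have qp : q <= p.
  rewrite leNgt; apply/negP => /ltW h.
  suff : p ^+ 4 <= q ^+ 4 by rewrite pq; lra.
  by rewrite lerXn2r ?nnegrE ?(ltW p0) ?(ltW q0).
have p0' := ltW p0; have q0' := ltW q0.
suff h : p ^- 4 <= 4 * (p - q).
  have := ler_wpM2l (mulr_ge0 (ler0n R 2) A0) h; lra.
rewrite -div1r ler_pdivrMr ?exprn_gt0 //.
have : 1 <= 4 * (p - q) * p ^+ 3.
  have E : (p - q) * (p ^+ 3 + p ^+ 2 * q + p * q ^+ 2 + q ^+ 3) = p ^+ 4 - q ^+ 4.
    by ring.
  rewrite pq (addrC (q ^+ 4)) addrK in E; rewrite -[X in X <= _]E.
  rewrite [leRHS](_ : _ = (p - q) * (4 * p ^+ 3)); last by ring.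
  rewrite ler_wpM2l ?subr_ge0 //.
  have h1 : p ^+ 2 * q <= p ^+ 3 by rewrite [leRHS]exprSr ler_wpM2l ?exprn_ge0.
  have h2 : q ^+ 2 <= p ^+ 2 by rewrite lerXn2r ?nnegrE.
  have h3 : p * q ^+ 2 <= p ^+ 3 by rewrite [leRHS]exprS ler_wpM2l.
  have h4 : q ^+ 3 <= p ^+ 3 by rewrite lerXn2r ?nnegrE.
  by lra.
move/le_trans; apply; rewrite [leRHS](_ : _ = 4 * (p - q) * p ^+ 3 * p); last by ring.
by rewrite ler_peMr // !mulr_ge0 ?subr_ge0 ?exprn_ge0.
Qed.

(** Up to the factor [r ^- 3], the errors obey the quicksort recurrence with toll [A * n.+1]. The
    induction keeps [r] and [y] general because conditioning on one part shifts [y], and replacing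
    the other part by a Gaussian enlarges [r]; the condition relating [n] and [r] is preserved,
    since sizes only decrease and [r] only increases. *)
Lemma heat_comparison L : 0 < L -> exists A, 0 <= A /\
  forall n r y, 0 < r -> Num.sqrt n.+1%:R <= L * r ->
  `|expect n (fun t => heat r (y - X t)) - heat (Num.sqrt (r ^+ 2 + v n)) y|
  <= comparison_error A n / r ^+ 3.
Proof.
move=> L0.
have [k [k0 vk]] := variance_le C_gt0 F_Tip F_Fork.
have [sigma2 [w [_ w0 vs]]] := variance_asymptotics C_gt0 F_Tip F_Fork.
pose D := 10 * C; have D0 : 0 < D by rewrite mulr_gt0.
have bD l r : `|b l r| <= D by exact: toll_le.
pose B : R := heat_bound R; have B0 : 0 < B by exact: heat_bound_gt0.
(* [A1] collects the Taylor remainder in space and [A2] the one in time. *)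
pose A1 := 2 * D * (k + D ^+ 2) * B.
pose A2 := 3 * w * k * B * L.
have [D0' B0' k0' L0'] := And4 (ltW D0) (ltW B0) (ltW k0) (ltW L0).
have A10 : 0 <= A1 :=
  mulr_ge0 (mulr_ge0 (mulr_ge0 (ler0n R 2) D0') (addr_ge0 k0' (sqr_ge0 D))) B0'.
have A20 : 0 <= A2 :=
  mulr_ge0 (mulr_ge0 (mulr_ge0 (mulr_ge0 (ler0n R 3) w0) k0') B0') L0'.
exists (A1 + A2); split; first exact: addr_ge0.
move=> n; have [m] := ubnP n; elim: m n => // m IH [|n] /ltnSE nm r y r0 nLr;
  have r0' := ltW r0.
  rewrite expect0 variance0 addr0 sqrtr_sqr (gtr0_norm r0).
  have -> : X Tip = 0 by rewrite /centered /mean /= expect0 subrr.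
  rewrite subr0 subrr normr0.
  exact: divr_ge0 (comparison_error_ge0 _ (addr_ge0 A10 A20)) (exprn_ge0 3 r0').
set N := n.+2%:R in nLr *.
have N1 : 1 <= N by rewrite ler1n.
have vij i j : (i + j)%N = n -> v i + v j <= k * N.
  move=> ij; have -> : N = i.+1%:R + j.+1%:R by rewrite -natrD addSn addnS ij.
  by rewrite mulrDr lerD.
have jm i j : (i + j)%N = n -> (j < m)%N.
  by move=> ij; apply: leq_ltn_trans nm; rewrite -ij leq_addl.
have im i j : (i + j)%N = n -> (i < m)%N by rewrite addnC; exact: jm.
have sij i j : (i + j)%N = n -> Num.sqrt i.+1%:R <= L * r.
  by move=> ij; apply: le_trans nLr; rewrite ler_sqrt // ler_nat -ij ltnS leqW ?leq_addr.
have sji i j : (i + j)%N = n -> Num.sqrt j.+1%:R <= L * r.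
  by rewrite addnC; exact: sij.
(* [G1] leaves out the toll and [G2] is its second-order effect; [Q i j] has both parts replaced by
   Gaussians, and [Qn] is the target. *)
pose S' l s := - (X l + X s).
pose G1 l s := heat r (y + S' l s).
pose G2 l s := - b l s * heat1 r y
  + (- b l s * S' l s + (- b l s) ^+ 2 / 2) * heat2 r y.
pose Q i j := heat (Num.sqrt (r ^+ 2 + (v i + v j))) y.
pose Qn := heat (Num.sqrt (r ^+ 2 + v n.+1)) y.
(* The recurrence for the variance, halved: the mean second-order effect of the toll is half of what
   the variance of the whole exceeds that of the parts by. *)
have tollE : average n (expect2 (fun l s => - b l s * S' l s + (- b l s) ^+ 2 / 2))
    = v n.+1 / 2 - average n (fun i j => (v i + v j) / 2).
  have -> : average n (fun i j => (v i + v j) / 2) = average n (fun i j => v i + v j) / 2.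
    by rewrite mulrC -averageZ; apply: eq_average => i j _; rewrite mulrC.
  rewrite varianceS -average_diag -mulrBl [_ + _ - _]addrAC subrr add0r.
  rewrite mulrC -averageZ; apply: eq_average => i j _.
  by rewrite -expect2Z; apply: eq_expect2 => l s _ _; rewrite /S'; field.
(* The term in [heat1] disappears because the centered toll averages to zero. *)
have G2E : average n (expect2 G2) =
    (v n.+1 / 2 - average n (fun i j => (v i + v j) / 2)) * heat2 r y.
  rewrite -tollE mulrC -averageZ -[RHS]add0r -(mulr0 (- heat1 r y)).
  rewrite -(average_toll F n) -averageZ -averageD; apply: eq_average => i j _.
  rewrite -!expect2Z -expect2D; apply: eq_expect2 => l s _ _; rewrite /G2; ring.
have e1 : `|average n (expect2 (fun l s => heat r (y - X (Fork l s)) - G1 l s - G2 l s))|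
    <= A1 * N / r ^+ 3.
  apply: average_norm_le => i j ij.
  pose H l s := 2 * D * (B / r ^+ 3) * ((X l + X s) ^+ 2 + D ^+ 2).
  apply: le_trans (_ : expect2 H i j <= _).
    apply: expect2_norm_le => l s _ _.
    rewrite centered_Fork (_ : y - _ = y + (S' l s + - b l s)); last by rewrite /S'; ring.
    apply: le_trans (heat_space_taylor _ _ _ r0) _; rewrite normrN.
    rewrite /H [leRHS]mulrAC ler_wpM2r //.
      exact: divr_ge0 B0' (exprn_ge0 3 r0').
    have -> : (X l + X s) ^+ 2 = `|S' l s| ^+ 2 by rewrite /S' normrN real_normK ?num_real.
    rewrite -mulrA mulrCA ler_pM ?sqr_ge0 //.
    have := bD l s; have := normr_ge0 (b l s); have := normr_ge0 (S' l s).
    move: `|S' l s| `|b l s| => p q p0 q0 qD.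
    apply: le_trans (_ : (p + D) ^+ 2 <= _).
      by rewrite lerXn2r ?nnegrE ?addr_ge0 ?lerD2l // ltW.
    by have := sqr_ge0 (p - D); lra.
  rewrite /H expect2Z expect2D expect2_cst expect2_sqr_centered.
  have rB : 0 <= 2 * D * (B / r ^+ 3) :=
    mulr_ge0 (mulr_ge0 (ler0n R 2) D0') (divr_ge0 B0' (exprn_ge0 3 r0')).
  rewrite (_ : A1 * N / r ^+ 3 = 2 * D * (B / r ^+ 3) * (k * N + D ^+ 2 * N)); last first.
    by rewrite /A1; field; rewrite gt_eqF.
  rewrite ler_wpM2l // lerD ?vij // ler_peMr ?sqr_ge0 //.
have e2 : `|average n (fun i j => expect2 G1 i j - Q i j)|
    <= average n (fun i j => comparison_error (A1 + A2) i
                             + comparison_error (A1 + A2) j) / r ^+ 3.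
  have r3 : 0 <= r ^- 3 by rewrite invr_ge0 exprn_ge0.
  rewrite mulrC -averageZ ler_norml -mulN1r -averageZ; apply/andP.
  suff h i j : (i + j)%N = n -> `|expect2 G1 i j - Q i j| <=
     r ^- 3 * (comparison_error (A1 + A2) i + comparison_error (A1 + A2) j).
    split; apply: le_average => i j /h; rewrite ?mulN1r.
      by rewrite ler_norml => /andP[].
    by rewrite ler_norml => /andP[].
  (* The two parts are replaced in turn: the right one at time [r ^+ 2] with [y] shifted by [X l],
     then the left one at the time [rho ^+ 2], which already contains the variance of the right
     one. *)
  move=> ij; set rho := Num.sqrt (r ^+ 2 + v j).
  have rrho : r <= rho.
    rewrite -[leLHS](gtr0_norm r0) -sqrtr_sqr ler_sqrt ?lerDl ?variance_ge0 //.
    by rewrite addr_ge0 ?sqr_ge0 ?variance_ge0.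
  have rho0 : 0 < rho := lt_le_trans r0 rrho.
  have QE : Q i j = heat (Num.sqrt (rho ^+ 2 + v i)) y.
    rewrite /Q /rho (sqr_sqrtr (addr_ge0 (sqr_ge0 r) (variance_ge0 F j))).
    by rewrite -addrA [v j + v i]addrC.
  have h1 : `|expect2 G1 i j - expect i (fun l => heat rho (y - X l))|
      <= r ^- 3 * comparison_error (A1 + A2) j.
    rewrite -expectB; apply: expect_norm_le => l _.
    have -> : expect j (fun s => G1 l s) = expect j (fun s => heat r (y - X l - X s)).
      by apply: eq_expect => s _; rewrite /G1 /S' opprD addrA.
    rewrite mulrC; exact: IH (jm _ _ ij) r (y - X l) r0 (sji _ _ ij).
  have h2 : `|expect i (fun l => heat rho (y - X l)) - Q i j|
      <= r ^- 3 * comparison_error (A1 + A2) i.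
    have ce0 := comparison_error_ge0 i (addr_ge0 A10 A20).
    have Lrho : Num.sqrt i.+1%:R <= L * rho.
      by apply: le_trans (sij _ _ ij) _; rewrite ler_wpM2l.
    rewrite QE mulrC; apply: le_trans (IH i (im _ _ ij) rho y rho0 Lrho) _.
    have rho3 : r ^+ 3 <= rho ^+ 3 by rewrite lerXn2r ?nnegrE // ltW.
    by rewrite ler_wpM2l // lef_pV2 ?posrE ?exprn_gt0.
  apply: le_trans (ler_distD (expect i (fun l => heat rho (y - X l))) _ _) _.
  by apply: le_trans (lerD h1 h2) _; rewrite -mulrDr [X in _ * X]addrC.
have e3 : `|average n (fun i j => Q i j - Qn - (v i + v j - v n.+1) / 2 * heat2 r y)|
    <= A2 * N / r ^+ 3.
  apply: average_norm_le => i j ij.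
  have sq q : 0 <= q -> Num.sqrt (r ^+ 2 + q) ^+ 2 = r ^+ 2 + q.
    by move=> q0; rewrite sqr_sqrtr // addr_ge0 ?sqr_ge0.
  have rs q : 0 <= q -> r <= Num.sqrt (r ^+ 2 + q).
    move=> q0; rewrite -[leLHS](gtr0_norm r0) -sqrtr_sqr ler_sqrt ?lerDl //.
    by rewrite addr_ge0 ?sqr_ge0.
  have vi0 := variance_ge0 F i; have vj0 := variance_ge0 F j.
  have vn0 := variance_ge0 F n.+1; have vij0 := addr_ge0 vi0 vj0.
  have := @heat_time_taylor R r (Num.sqrt (r ^+ 2 + (v i + v j)))
    (Num.sqrt (r ^+ 2 + v n.+1)) (k * N) y r0 (rs _ vij0) (rs _ vn0).
  rewrite !sq // !lerD2l => /(_ (vij _ _ ij) (vk n.+1)).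
  rewrite (_ : r ^+ 2 + (v i + v j) - (r ^+ 2 + v n.+1) = v i + v j - v n.+1); last by ring.
  move/le_trans; apply.
  (* The linear parts of the variances cancel, and each square root error is at most [w * (L * r)].
     One factor [r] gained here turns [r ^- 4] into [r ^- 3]. *)
  have ev : `|v i + v j - v n.+1| <= 3 * w * (L * r).
    have le3 q : Num.sqrt q <= L * r -> w * Num.sqrt q <= w * (L * r).
      exact: ler_wpM2l.
    have := le_trans (vs i) (le3 _ (sij _ _ ij)).
    have := le_trans (vs j) (le3 _ (sji _ _ ij)).
    have := le_trans (vs n.+1) (le3 _ nLr).
    have -> : n.+2%:R = i.+1%:R + j.+1%:R :> R by rewrite -natrD addSn addnS ij.
    rewrite !ler_norml => /andP[? ?] /andP[? ?] /andP[? ?].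
    by apply/andP; split; lra.
  have kN0 : 0 <= k * N * (B / r ^+ 4) :=
    mulr_ge0 (mulr_ge0 k0' (le_trans ler01 N1)) (divr_ge0 B0' (exprn_ge0 4 r0')).
  rewrite -mulrA mulrA -[X in X <= _]mulrA.
  apply: le_trans (ler_wpM2r kN0 ev) _.
  by rewrite le_eqVlt; apply/orP; left; apply/eqP; rewrite /A2; field; rewrite gt_eqF.
(* The mean of [G2] and the first-order time term are opposite and drop out. *)
have total : expect n.+1 (fun t => heat r (y - X t)) - Qn =
    average n (expect2 (fun l s => heat r (y - X (Fork l s)) - G1 l s - G2 l s))
    + average n (fun i j => expect2 G1 i j - Q i j)
    + average n (fun i j => Q i j - Qn - (v i + v j - v n.+1) / 2 * heat2 r y).
  have -> : average n (expect2 (fun l s => heat r (y - X (Fork l s)) - G1 l s - G2 l s))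
      = expect n.+1 (fun t => heat r (y - X t)) - average n (expect2 G1)
        - average n (expect2 G2).
    by rewrite expect_fork -!averageB; apply: eq_average => i j _; rewrite !expect2B.
  rewrite G2E averageB.
  have -> : average n (fun i j => Q i j - Qn - (v i + v j - v n.+1) / 2 * heat2 r y)
     = average n Q - Qn
       - (average n (fun i j => (v i + v j) / 2) - v n.+1 / 2) * heat2 r y.
    rewrite !averageB average_cst; congr (_ - _).
    rewrite [RHS]mulrC -(average_cst n (v n.+1 / 2)) -averageB -averageZ.
    by apply: eq_average => i j _; rewrite mulrC mulrBl.
  move: (expect _ _) (average n (expect2 G1)) (average n Q) (Qn) (v n.+1 / 2)
    (average n _) (heat2 r y) => a1 a2 a3 a4 a5 a6 a7.
  by ring.
rewrite total -comparison_errorS -/N mulrDl.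
apply: le_trans (ler_normD _ _) _.
apply: le_trans (lerD (ler_normD _ _) (lexx _)) _.
apply: le_trans (lerD (lerD e1 e2) e3) _.
by rewrite mulrDl; lra.
Qed.

End HeatComparison.

(** * Removing the smoothing *)

Section LimitLaw.

Variable R : realType.
Local Open Scope classical_set_scope.
Local Notation Phi := (normal_cdf (1 : R)).

Lemma continuous_normal_cdf (x : R) : {for x, continuous Phi}.
Proof.
have n10 : (1 : R) != 0 by rewrite oner_neq0.
have := is_derive_normal_cdf x n10.
by move=> [d _]; apply/differentiable_continuous/derivable1_diffP.
Qed.

(** The smoothing has standard deviation [k ^+ 2 * s], so the shift [k * s] amounts to [k^-1]
    deviations. As [k] tends to 0 both the tail of the smoothing and the shift, measured in units of
    [s], vanish. *)
Lemma ler_indic_heat (k s z X : R) : 0 < k -> 0 < s ->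
  heat (k ^+ 2 * s) (z - k * s - X) - Phi (- k^-1) <= (X <= z)%R%:R
  <= heat (k ^+ 2 * s) (z + k * s - X) + (1 - Phi (k^-1)).
Proof.
move=> k0 s0; have r0 : 0 < k ^+ 2 * s by rewrite mulr_gt0 ?exprn_gt0.
have kE : k^-1 = k * s / (k ^+ 2 * s) by field; rewrite !gt_eqF.
have rV : 0 <= (k ^+ 2 * s)^-1 by rewrite invr_ge0 ltW.
have up : X <= z -> k * s / (k ^+ 2 * s) <= (z + k * s - X) / (k ^+ 2 * s).
  by move=> Xz; apply: (ler_wpM2r rV); lra.
have down : z < X -> (z - k * s - X) / (k ^+ 2 * s) <= - (k * s / (k ^+ 2 * s)).
  by move=> zX; rewrite -[X in _ <= X]mulNr; apply: (ler_wpM2r rV); lra.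
rewrite /heat; have [Xz|zX] /= := leP X z; apply/andP; split.
- rewrite lerBlDr (le_trans (normal_cdf_le1 _ _)) // lerDl; exact: normal_cdf_ge0.
- by rewrite addrCA lerDl subr_ge0; apply: normal_cdf_nondecreasing; rewrite kE; exact: up.
- by rewrite subr_le0; apply: normal_cdf_nondecreasing; rewrite kE; exact: down.
- by rewrite addr_ge0 ?normal_cdf_ge0 // subr_ge0 normal_cdf_le1.
Qed.

Lemma cvg_inv_sqrt : (fun n => (Num.sqrt n.+1%:R)^-1 : R) @ \oo --> (0 : R).
Proof.
rewrite -[X in _ --> X](@sqrtr0 R).
have -> : (fun n => (Num.sqrt n.+1%:R)^-1 : R) = Num.sqrt \o harmonic.
  by apply/funext => n /=; rewrite sqrtrV.
by apply: cvg_comp; [exact: cvg_harmonic|exact: sqrt_continuous].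
Qed.

Lemma cvg_inv_sqrt_sqrt :
  (fun n => (Num.sqrt (Num.sqrt n.+1%:R))^-1 : R) @ \oo --> (0 : R).
Proof.
rewrite -[X in _ --> X](@sqrtr0 R).
have -> : (fun n => (Num.sqrt (Num.sqrt n.+1%:R))^-1 : R) =
    Num.sqrt \o (fun n => (Num.sqrt n.+1%:R)^-1).
  by apply/funext => n /=; rewrite sqrtrV ?sqrtr_ge0.
by apply: cvg_comp; [exact: cvg_inv_sqrt|exact: sqrt_continuous].
Qed.

Lemma near_dist_le (u : nat -> R) (l eps : R) : u @ \oo --> l -> 0 < eps ->
  \forall n \near \oo, `|l - u n| <= eps.
Proof. by move=> /cvgrPdist_le ul eps0; exact: ul. Qed.

Lemma cvg_dominated (u e : nat -> R) (l c : R) : e @ \oo --> (0 : R) ->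
  (forall n, `|u n - l| <= c * e n) -> u @ \oo --> l.
Proof.
move=> e0 ule; apply/subr_cvg0/norm_cvg0P.
have ce0 : (fun n => c * e n) @ \oo --> (0 : R).
  by rewrite -[X in _ --> X](mulr0 c); apply: cvgM e0; exact: cvg_cst.
apply: (@squeeze_cvgr _ _ _ _ (cst (0 : R)) _ _ _ _ (cvg_cst _) ce0).
by apply: nearW => n /=; rewrite normr_ge0 /=; exact: ule.
Qed.

(** [heat] depends only on the quotient of its arguments, so everything can be divided by the square
    root of [n.+1]. *)
Lemma cvg_heat_scaled (z v : nat -> R) (x sigma2 k c K w : R) :
  0 < k -> 0 <= sigma2 -> (forall n, 0 <= v n) ->
  (forall n, `|z n - x * Num.sqrt n.+1%:R| <= K) ->
  (forall n, `|v n - sigma2 * n.+1%:R| <= w * Num.sqrt n.+1%:R) ->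
  (fun n => heat (Num.sqrt ((k ^+ 2 * Num.sqrt n.+1%:R) ^+ 2 + v n))
              (z n + c * Num.sqrt n.+1%:R)) @ \oo -->
  Phi ((x + c) / Num.sqrt (k ^+ 4 + sigma2)).
Proof.
move=> k0 s0 v0 zx vs.
pose s n : R := Num.sqrt n.+1%:R.
have sgt0 n : 0 < s n by rewrite sqrtr_gt0.
have ss n : s n ^+ 2 = n.+1%:R by rewrite sqr_sqrtr.
have zs : (fun n => z n / s n) @ \oo --> x.
  apply: (cvg_dominated (c := K) cvg_inv_sqrt) => n; rewrite -/(s n).
  rewrite (_ : z n / s n - x = (z n - x * s n) / s n); last by field; rewrite gt_eqF.
  by rewrite normrM normfV (gtr0_norm (sgt0 n)) ler_wpM2r ?invr_ge0 ?(ltW (sgt0 n)) ?zx.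
have vss : (fun n => v n / s n ^+ 2) @ \oo --> sigma2.
  apply: (cvg_dominated (c := w) cvg_inv_sqrt) => n; rewrite -/(s n).
  rewrite (_ : v n / s n ^+ 2 - sigma2 = (v n - sigma2 * s n ^+ 2) / s n ^+ 2);
    last by field; rewrite gt_eqF.
  rewrite normrM normfV (gtr0_norm (exprn_gt0 2 (sgt0 n))) ler_pdivrMr ?exprn_gt0 //.
  rewrite [leRHS](_ : _ = w * s n); last by field; rewrite gt_eqF.
  by rewrite ss; exact: vs.
have -> : (fun n => heat (Num.sqrt ((k ^+ 2 * Num.sqrt n.+1%:R) ^+ 2 + v n))
                (z n + c * Num.sqrt n.+1%:R)) =
    Phi \o (fun n => (z n / s n + c) / Num.sqrt (k ^+ 4 + v n / s n ^+ 2)).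
  apply/funext => n; rewrite /heat /= -/(s n); congr (Phi _).
  have -> : (k ^+ 2 * s n) ^+ 2 + v n = (k ^+ 4 + v n / s n ^+ 2) * s n ^+ 2.
    by field; rewrite gt_eqF.
  have kv : 0 < k ^+ 4 + v n / s n ^+ 2.
    by rewrite ltr_wpDr ?exprn_gt0 // divr_ge0 ?exprn_ge0 // ltW.
  rewrite sqrtrM ?(ltW kv) // sqrtr_sqr gtr0_norm //.
  have := sqrtr_gt0 (k ^+ 4 + v n / s n ^+ 2); rewrite kv.
  by move: (Num.sqrt _) => q q0; field; rewrite !gt_eqF.
apply: cvg_comp; last exact: continuous_normal_cdf.
apply: cvgM; first by apply: cvgD zs _; exact: cvg_cst.
apply: cvgV; first by rewrite gt_eqF // sqrtr_gt0 ltr_wpDr // exprn_gt0.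
apply: (cvg_comp _ Num.sqrt); last exact: sqrt_continuous.
by apply: cvgD vss; exact: cvg_cst.
Qed.

(** For [sigma2 = 0] this is the distribution function of the point mass at 0 except at [x = 0],
    where that function is discontinuous. *)
Definition limit_cdf (sigma2 x : R) : R :=
  if sigma2 == 0 then (0 < x)%R%:R else Phi (x / Num.sqrt sigma2).

(** The numerator tends to [x > 0] while the denominator is [k ^+ 2]. *)
Let cvg_ratio_y (x c : R) : 0 < x -> `|c| <= 1 ->
  (fun k => (x + c * k) / Num.sqrt (k ^+ 4 + 0)) @ (0 : R)^'+ --> +oo.
Proof.
move=> x0 c1; apply/cvgryPge => A.
have A1 : 0 < 2 * (`|A| + 1) by rewrite mulr_gt0 // ltr_wpDl.
near=> k.
have k0 : 0 < k by near: k; exact: nbhs_right_gt.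
have k1 : k <= 1 by near: k; apply: nbhs_right_le.
have kx : k <= x / 2 by near: k; apply: nbhs_right_le; rewrite divr_gt0.
have kA : k <= x / (2 * (`|A| + 1)) by near: k; apply: nbhs_right_le; rewrite divr_gt0.
rewrite addr0 (_ : k ^+ 4 = (k ^+ 2) ^+ 2); last by ring.
rewrite sqrtr_sqr gtr0_norm ?exprn_gt0 // ler_pdivlMr ?exprn_gt0 //.
have ck : - k <= c * k.
  by move: c1; rewrite ler_norml => /andP[c1 _]; nra.
move: kA; rewrite ler_pdivlMr // => kA.
have h : A * k ^+ 2 <= (`|A| + 1) * k.
  have k2 : k ^+ 2 <= k by rewrite expr2 ler_piMl // ltW.
  have A2 := ler_norm A; have A3 : 0 <= `|A| by [].
  apply: le_trans (_ : (`|A| + 1) * k ^+ 2 <= _).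
    by rewrite ler_wpM2r ?exprn_ge0 ?(ltW k0) //; lra.
  by rewrite ler_wpM2l //; lra.
by lra.
Unshelve. all: by end_near. Qed.

Lemma cvg_limit_cdf (sigma2 x c : R) : 0 <= sigma2 -> (sigma2 = 0 -> x != 0) ->
  `|c| <= 1 ->
  (fun k => Phi ((x + c * k) / Num.sqrt (k ^+ 4 + sigma2))) @ (0 : R)^'+ -->
  limit_cdf sigma2 x.
Proof.
rewrite /limit_cdf le_eqVlt => /predU1P[<- /(_ erefl) x0 c1|s0 _ _].
  rewrite eqxx.
  have -> : (fun k => Phi ((x + c * k) / Num.sqrt (k ^+ 4 + 0))) =
      Phi \o (fun k => (x + c * k) / Num.sqrt (k ^+ 4 + 0)) by [].
  have [x_gt0|x_lt0|x_eq0] /= := ltgtP 0 x; last by rewrite -x_eq0 eqxx in x0.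
    by apply: cvg_comp (@cvg_normal_cdfy R 1); exact: cvg_ratio_y.
  have Nx0 : 0 < - x by rewrite oppr_gt0.
  have Nc1 : `|- c| <= 1 by rewrite normrN.
  apply: cvg_comp (@cvg_normal_cdfNy R 1).
  apply/cvgNry; move: (cvg_ratio_y Nx0 Nc1); apply: cvg_trans.
  apply: near_eq_cvg; apply: nearW => k /=.
  by rewrite mulNr -opprD mulNr.
rewrite gt_eqF //.
have -> : (fun k => Phi ((x + c * k) / Num.sqrt (k ^+ 4 + sigma2))) =
    Phi \o (fun k => (x + c * k) / Num.sqrt (k ^+ 4 + sigma2)) by [].
apply: cvg_comp; last exact: continuous_normal_cdf.
have k0 : (fun k : R => k) @ (0 : R)^'+ --> (0 : R).
  by apply: cvg_at_right_filter; exact: cvg_id.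
have k4 : (fun k : R => k ^+ 4 + sigma2) @ (0 : R)^'+ --> sigma2.
  rewrite -[X in _ --> X]add0r; apply: cvgD; last exact: cvg_cst.
  have -> : (fun k : R => k ^+ 4) = (fun k => k * (k * (k * k))).
    by apply/funext => k; ring.
  have := cvgM k0 (cvgM k0 (cvgM k0 k0)); rewrite !mul0r; exact.
apply: cvgM.
  rewrite -[X in _ --> X]addr0; apply: cvgD; first exact: cvg_cst.
  by rewrite -[X in _ --> X](mulr0 c); apply: cvgM k0; exact: cvg_cst.
apply: cvgV; first by rewrite gt_eqF // sqrtr_gt0.
exact: (cvg_comp _ Num.sqrt) k4 (@sqrt_continuous _ _).
Qed.

Lemma cvg_normal_cdf_inv :
  ((fun k : R => Phi (k^-1)) @ (0 : R)^'+ --> (1 : R)) /\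
  ((fun k : R => Phi (- k^-1)) @ (0 : R)^'+ --> (0 : R)).
Proof.
have ky : (fun k : R => k^-1) @ (0 : R)^'+ --> +oo.
  by apply/cvgrVy; [exact: nbhs_right_gt|apply: cvg_at_right_filter; exact: cvg_id].
split; first exact: cvg_comp ky (@cvg_normal_cdfy R 1).
by apply: cvg_comp (@cvg_normal_cdfNy R 1); apply/cvgNrNy.
Qed.

End LimitLaw.

(** * The normal limit of additive functionals *)

Section CentralLimitTheorem.
Variables (R : realType) (F : shape -> R) (C : R).
Hypothesis C_gt0 : 0 < C.
Hypothesis F_Tip : `|F Tip| <= C.
Hypothesis F_Fork : forall l r, `|F (Fork l r) - F l - F r| <= C.
Local Open Scope classical_set_scope.
Local Notation Phi := (normal_cdf (1 : R)).

(** With [r] equal to [k ^+ 2] times the square root of [n.+1], the comparison applies with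
    [L = k ^- 2], and its error is of order 5/4 - 3/2 = -1/4 in [n] for fixed [k]. *)
Lemma heat_comparison_cvg (k : R) : 0 < k -> exists e : nat -> R,
  e @ \oo --> (0 : R) /\ forall n y,
  `|expect n (fun t => heat (k ^+ 2 * Num.sqrt n.+1%:R) (y - centered F t))
    - heat (Num.sqrt ((k ^+ 2 * Num.sqrt n.+1%:R) ^+ 2 + variance F n)) y| <= e n.
Proof.
move=> k0.
have L0 : 0 < k ^- 2 by rewrite invr_gt0 exprn_gt0.
have [A [A0 H]] := heat_comparison C_gt0 F_Tip F_Fork L0.
exists (fun n => 8 * A / k ^+ 6 * (Num.sqrt (Num.sqrt n.+1%:R))^-1); split.
  rewrite -[X in _ --> X](mulr0 (8 * A / k ^+ 6)).
  by apply: cvgM; [exact: cvg_cst|exact: cvg_inv_sqrt_sqrt].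
move=> n y.
have s0 : 0 < Num.sqrt n.+1%:R :> R by rewrite sqrtr_gt0.
have q0 : 0 < Num.sqrt (Num.sqrt n.+1%:R) :> R by rewrite sqrtr_gt0.
have r0 : 0 < k ^+ 2 * Num.sqrt n.+1%:R by rewrite mulr_gt0 ?exprn_gt0.
have k2 : k ^- 2 * (k ^+ 2 * Num.sqrt n.+1%:R) = Num.sqrt n.+1%:R.
  by rewrite mulKf // expf_neq0 // gt_eqF.
have le_s : Num.sqrt n.+1%:R <= k ^- 2 * (k ^+ 2 * Num.sqrt n.+1%:R) by rewrite k2.
apply: le_trans (H n _ y r0 le_s) _.
rewrite ler_pdivrMr ?exprn_gt0 //.
apply: le_trans (comparison_error_le _ A0) _.
rewrite -[X in _ * X * _ <= _](sqr_sqrtr (ler0n R n.+1)).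
move: (Num.sqrt (Num.sqrt n.+1%:R)) (sqr_sqrtr (ltW s0)) q0 => q <- q0.
rewrite le_eqVlt; apply/orP; left; apply/eqP; field.
by rewrite !gt_eqF.
Qed.

(** The threshold [zeta] is fixed only up to a bounded error, which the scaling by a square root
    absorbs. This covers centering by the exact mean as well as models whose size differs from the
    number of tips by a constant. *)
Lemma additive_clt : exists mu sigma2 : R, 0 <= sigma2 /\
  forall (zeta : nat -> R) (x K : R),
  (forall n, `|zeta n - mu * n.+1%:R - x * Num.sqrt n.+1%:R| <= K) ->
  (sigma2 = 0 -> x != 0) ->
  (fun n => expect n (fun t => (F t <= zeta n)%R%:R)) @ \oo --> limit_cdf sigma2 x.
Proof.
have [mu muP] := mean_asymptotics F_Tip F_Fork.
have [sigma2 [w [s0 w0 vs]]] := variance_asymptotics C_gt0 F_Tip F_Fork.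
exists mu, sigma2; split => // zeta x K zx sx.
pose z n := zeta n - mean F n.
pose p n : R := expect n (fun t => (centered F t <= z n)%R%:R).
have -> : (fun n => expect n (fun t => (F t <= zeta n)%R%:R)) = p.
  apply/funext => n; apply: eq_expect => t tn.
  by rewrite /z /centered tn lerD2r.
have zK n : `|z n - x * Num.sqrt n.+1%:R| <= K + 3 * C.
  rewrite (_ : _ - _ = zeta n - mu * n.+1%:R - x * Num.sqrt n.+1%:R
    - (mean F n - mu * n.+1%:R)); last by rewrite /z; ring.
  by rewrite (le_trans (ler_normB _ _)) // lerD.
have [Phi1 Phi0] := cvg_normal_cdf_inv R.
apply/cvgrPdist_le => eps eps0.
have e4 : 0 < eps / 4 by rewrite divr_gt0.
have n1 : `|1 : R| <= 1 by rewrite normr1.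
have nN1 : `|- 1 : R| <= 1 by rewrite normrN1.
(* [k] is chosen before [n], since the rate of the comparison depends on [k]. The four quarters of
   [eps] pay for the shift and the tail of the smoothing, the limit of [heat], and the
   comparison. *)
near (0 : R)^'+ => k.
have k0 : 0 < k by near: k; exact: nbhs_right_gt.
have kU : `|limit_cdf sigma2 x - Phi ((x + 1 * k) / Num.sqrt (k ^+ 4 + sigma2))| <= eps / 4.
  near: k; apply: cvgr_dist_le e4; exact: cvg_limit_cdf.
have kL : `|limit_cdf sigma2 x - Phi ((x + (- 1) * k) / Num.sqrt (k ^+ 4 + sigma2))| <= eps / 4.
  near: k; apply: cvgr_dist_le e4; exact: cvg_limit_cdf.
have k1 : `|1 - Phi (k^-1)| <= eps / 4 by near: k; exact: cvgr_dist_le e4.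
have kN1 : `|0 - Phi (- k^-1)| <= eps / 4 by near: k; exact: cvgr_dist_le e4.
have [e [e0 eP]] := heat_comparison_cvg k0.
have cvgU := cvg_heat_scaled (c := k) k0 s0 (variance_ge0 F) zK vs.
have cvgL := cvg_heat_scaled (c := - k) k0 s0 (variance_ge0 F) zK vs.
rewrite mul1r in kU; rewrite mulN1r in kL.
have ne := near_dist_le e0 e4; have nU := near_dist_le cvgU e4.
have nL := near_dist_le cvgL e4.
near=> n.
have en : `|0 - e n| <= eps / 4 by near: n; exact: ne.
have hU : `|Phi ((x + k) / Num.sqrt (k ^+ 4 + sigma2))
    - heat (Num.sqrt ((k ^+ 2 * Num.sqrt n.+1%:R) ^+ 2 + variance F n))
        (z n + k * Num.sqrt n.+1%:R)| <= eps / 4.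
  by near: n; exact: nU.
have hL : `|Phi ((x - k) / Num.sqrt (k ^+ 4 + sigma2))
    - heat (Num.sqrt ((k ^+ 2 * Num.sqrt n.+1%:R) ^+ 2 + variance F n))
        (z n + (- k) * Num.sqrt n.+1%:R)| <= eps / 4.
  by near: n; exact: nL.
have s_gt0 : 0 < Num.sqrt n.+1%:R :> R by rewrite sqrtr_gt0.
have pU : p n <= expect n (fun t => heat (k ^+ 2 * Num.sqrt n.+1%:R)
    (z n + k * Num.sqrt n.+1%:R - centered F t)) + (1 - Phi (k^-1)).
  rewrite -[X in _ <= _ + X](expect_cst n) -expectD; apply: le_expect => t _.
  by have /andP[] := ler_indic_heat (z n) (centered F t) k0 s_gt0.
have pL : expect n (fun t => heat (k ^+ 2 * Num.sqrt n.+1%:R)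
    (z n - k * Num.sqrt n.+1%:R - centered F t)) - Phi (- k^-1) <= p n.
  rewrite -[X in _ - X <= _](expect_cst n) -expectB; apply: le_expect => t _.
  by have /andP[] := ler_indic_heat (z n) (centered F t) k0 s_gt0.
have := eP n (z n + k * Num.sqrt n.+1%:R).
have := eP n (z n - k * Num.sqrt n.+1%:R).
rewrite mulNr in hL.
move: pU pL hU hL en k1 kN1 kU kL.
move: (expect n _) (expect n _) (heat _ _) (heat _ _) => a1 a2 a3 a4.
move: (Phi _) (Phi _) (Phi _) (Phi _) (p n) (e n) (limit_cdf _ _).
clear => b1 b2 b3 b4 q f l h1 h2.
rewrite !ler_norml => /andP[? ?] /andP[? ?] /andP[? ?] /andP[? ?] /andP[? ?]
  /andP[? ?] /andP[? ?] /andP[? ?] /andP[? ?].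
by apply/andP; split; lra.
Unshelve. all: by end_near. Qed.

End CentralLimitTheorem.

(** * Eigenvalue multiplicities of shapes *)

Section ShapeMatrices.
Variable R : realFieldType.

Lemma mxrank_addl_diff (m n : nat) (A B : 'M[R]_(m, n)) :
  (\rank (A + B)%R <= \rank A + \rank B /\ \rank A <= \rank (A + B)%R + \rank B)%N.
Proof.
split; first exact: mxrank_add.
by rewrite -{1}(addrK B A) -(mxrank_opp B); exact: mxrank_add.
Qed.

Lemma mxrank_outer_le (m n : nat) (x : 'rV[R]_m) (y : 'rV[R]_n) :
  (\rank (x^T *m y)%R <= 1)%N.
Proof. exact: leq_trans (mxrankM_maxr _ _) (rank_leq_row _). Qed.

(* The tree graph of a recursive tree in terms of the binary shape splitting it
   at the edge from the root to its first child: the vertices are the tips, the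
   subtree of the first child is on the left, and the root is the last tip. *)
Fixpoint rec_root (t : shape) : 'rV[R]_(tips t) :=
  if t is Fork l r then row_mx 0 (rec_root r) else 1%:M.

Fixpoint rec_adj (t : shape) : 'M[R]_(tips t) :=
  if t is Fork l r then
    block_mx (rec_adj l) ((rec_root l)^T *m rec_root r)
             ((rec_root r)^T *m rec_root l) (rec_adj r)
  else 0.

(* For binary trees, the vertices are the forks. *)
Definition bin_root (t : shape) : 'rV[R]_(forks t) :=
  if t is Fork l r then row_mx 1%:M 0 else 0.

Fixpoint bin_adj (t : shape) : 'M[R]_(forks t) :=
  if t is Fork l r then
    block_mx 0 (row_mx (bin_root l) (bin_root r))
             (row_mx (bin_root l) (bin_root r))^T
             (block_mx (bin_adj l) 0 0 (bin_adj r))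
  else 0.

Lemma tr_rec_adj t : (rec_adj t)^T = rec_adj t.
Proof.
elim: t => [|l IHl r IHr] /=; first by rewrite trmx0.
by rewrite tr_block_mx IHl IHr !trmx_mul !trmxK.
Qed.

Lemma tr_bin_adj t : (bin_adj t)^T = bin_adj t.
Proof.
elim: t => [|l IHl r IHr] /=; first by rewrite trmx0.
by rewrite !tr_block_mx IHl IHr !trmx0 trmxK.
Qed.

Variable a : R.

Definition rec_mult t : nat := mup a (char_poly (rec_adj t)).
Definition bin_mult t : nat := mup a (char_poly (bin_adj t)).

Lemma rec_mult_Tip : (rec_mult Tip <= 1)%N.
Proof.
have E : (rec_mult Tip + _)%N = 1%N := mup_char_poly_sym a (tr_rec_adj Tip).
by rewrite -[leqRHS]E leq_addr.
Qed.

Lemma bin_mult_Tip : bin_mult Tip = 0%N.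
Proof.
have E : (bin_mult Tip + _)%N = 0%N := mup_char_poly_sym a (tr_bin_adj Tip).
by apply/eqP; rewrite -leqn0 -[leqRHS]E leq_addr.
Qed.

Let corank_arith (m ml mr tl tr q q1 rl rr d1 d2 : nat) :
  (m + q = tl + tr)%N -> (d1 <= 1)%N -> (d2 <= 1)%N ->
  (q1 <= rl + rr + d2)%N /\ (rl + rr <= q1 + d2)%N ->
  (q <= q1 + d1)%N /\ (q1 <= q + d1)%N ->
  (mr + rr = tr)%N -> (ml + rl = tl)%N ->
  (m <= ml + mr + 2)%N /\ (ml + mr <= m + 2)%N.
Proof. lia. Qed.

Let corank_arith1 (m ml mr tl tr q q1 rl rr d1 d2 c : nat) :
  (m + q = 1 + (tl + tr))%N -> (c <= 1)%N -> (d1 <= 1)%N -> (d2 <= 1)%N ->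
  (q1 <= c + (rl + rr) + d2)%N /\ (c + (rl + rr) <= q1 + d2)%N ->
  (q <= q1 + d1)%N /\ (q1 <= q + d1)%N ->
  (mr + rr = tr)%N -> (ml + rl = tl)%N ->
  (m <= ml + mr + 3)%N /\ (ml + mr <= m + 3)%N.
Proof. lia. Qed.

(** The multiplicity is the dimension minus the rank, dimensions add up, and the cut edge consists
    of two outer products, each changing the rank by at most 1. *)
Lemma rec_mult_Fork l r :
  (rec_mult (Fork l r) <= rec_mult l + rec_mult r + 2 /\
   rec_mult l + rec_mult r <= rec_mult (Fork l r) + 2)%N.
Proof.
have E : (rec_mult (Fork l r) + _)%N = (tips l + tips r)%N :=
  mup_char_poly_sym a (tr_rec_adj (Fork l r)).
have := mup_char_poly_sym a (tr_rec_adj l).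
have := mup_char_poly_sym a (tr_rec_adj r).
rewrite -/(rec_mult l) -/(rec_mult r).
pose A := block_mx (rec_adj l - a%:M) 0 0 (rec_adj r - a%:M).
pose x := row_mx (rec_root l) 0 : 'rV_(tips l + tips r).
pose y := row_mx 0 (rec_root r) : 'rV_(tips l + tips r).
have AE : rec_adj (Fork l r) - a%:M = A + x^T *m y + y^T *m x.
  rewrite /A /x /y /= !tr_row_mx !mul_col_row !trmx0 !mul0mx !mulmx0.
  rewrite scalar_mx_block opp_block_mx !add_block_mx.
  by rewrite !addr0 !add0r !oppr0 !addr0.
have := mxrank_addl_diff (A + x^T *m y) (y^T *m x).
have := mxrank_addl_diff A (x^T *m y).
have := mxrank_outer_le x y; have := mxrank_outer_le y x.
move: E; rewrite AE rank_diag_block_mx; exact: corank_arith.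
Qed.

(** The edges at the root, taken together, are again two outer products; the root itself adds one
    dimension and a diagonal entry of rank at most 1, hence 3. *)
Lemma bin_mult_Fork l r :
  (bin_mult (Fork l r) <= bin_mult l + bin_mult r + 3 /\
   bin_mult l + bin_mult r <= bin_mult (Fork l r) + 3)%N.
Proof.
have E : (bin_mult (Fork l r) + _)%N = (1 + (forks l + forks r))%N :=
  mup_char_poly_sym a (tr_bin_adj (Fork l r)).
have := mup_char_poly_sym a (tr_bin_adj l).
have := mup_char_poly_sym a (tr_bin_adj r).
rewrite -/(bin_mult l) -/(bin_mult r).
pose D := block_mx (bin_adj l - a%:M) 0 0 (bin_adj r - a%:M).
pose A := block_mx (- a%:M : 'M[R]_(1, 1)) 0 0 D.
pose w := row_mx (bin_root l) (bin_root r).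
pose x := row_mx 1%:M 0 : 'rV[R]_(1 + (forks l + forks r)).
pose y := row_mx 0 w : 'rV_(1 + (forks l + forks r)).
have AE : bin_adj (Fork l r) - a%:M = A + x^T *m y + y^T *m x.
  rewrite /A /x /y /= !tr_row_mx !mul_col_row !trmx0 !mul0mx !mulmx0 trmx1 mul1mx mulmx1.
  rewrite scalar_mx_block opp_block_mx !add_block_mx.
  rewrite !addr0 !add0r !oppr0 !addr0; congr block_mx.
  by rewrite scalar_mx_block opp_block_mx add_block_mx !oppr0 !addr0.
have := mxrank_addl_diff (A + x^T *m y) (y^T *m x).
have := mxrank_addl_diff A (x^T *m y).
have := mxrank_outer_le x y; have := mxrank_outer_le y x.
have : (\rank (- a%:M : 'M[R]_(1, 1))%R <= 1)%N by exact: rank_leq_row.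
move: E; rewrite AE !rank_diag_block_mx; exact: corank_arith1.
Qed.

(** [P] will be the matrix placing the vertices of a shape among the labels. The sizes are related
    by an equation because the number of vertices of a shape is computed from the shape. *)
Lemma mup_char_poly_relabel (m n : nat) (P : 'M[R]_(m, n)) (A : 'M[R]_m) (B : 'M[R]_n) :
  m = n -> P^T *m P = 1%:M -> P^T *m A *m P = B -> A^T = A ->
  mup a (char_poly B) = mup a (char_poly A).
Proof.
move=> mn; case: n / mn P B => P B PP PAP As.
have Bs : B^T = B by rewrite -PAP !trmx_mul trmxK As mulmxA.
have := mup_char_poly_sym a As; have := mup_char_poly_sym a Bs.
have -> : B - a%:M = P^T *m (A - a%:M) *m P.
  by rewrite mulmxBr mulmxBl PAP mul_mx_scalar -scalemxAl PP scalemx1.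
have Pu : P \in unitmx by have [] := mulmx1_unit PP.
have Ptu : P^T \in unitmx by rewrite unitmx_tr.
rewrite mxrankMfree ?row_free_unit // eqmxMfull ?row_full_unit //; lia.
Qed.

End ShapeMatrices.

(** * Growth histories of labelled trees *)

Section LabelledTrees.
Variable X : eqType.

(** A common encoding for both models: a leaf label names a place where the next vertex can be
    attached, a node stores the step that created it, and the parameters [a] and [b] below give the
    two labels that replace a used one. *)
Inductive ltree := Leaf of X | Node of ltree & nat & ltree.

Fixpoint erase (t : ltree) : shape :=
  if t is Node l _ r then Fork (erase l) (erase r) else Tip.

Fixpoint leaves (t : ltree) : seq X :=
  match t with Leaf x => [:: x] | Node l _ r => leaves l ++ leaves r end.

Fixpoint nodes (t : ltree) : seq nat :=
  if t is Node l k r then k :: nodes l ++ nodes r else [::].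

Variables a b : nat -> X -> X.

Fixpoint sprout (k : nat) (x : X) (t : ltree) : ltree :=
  match t with
  | Leaf y => if y == x then Node (Leaf (a k x)) k (Leaf (b k x)) else t
  | Node l j r => Node (sprout k x l) j (sprout k x r)
  end.

Lemma sprout_id k x t : x \notin leaves t -> sprout k x t = t.
Proof.
elim: t => [y|l IHl j r IHr] /=; first by rewrite inE eq_sym => /negPf ->.
by rewrite mem_cat negb_or => /andP[/IHl -> /IHr ->].
Qed.

Lemma leaves_cat_disjoint (l r : ltree) x :
  uniq (leaves l ++ leaves r) ->
  (x \in leaves l -> x \notin leaves r) /\ (x \in leaves r -> x \notin leaves l).
Proof.
rewrite cat_uniq => /and3P[_ /hasPn lr _]; split => [xl|xr].
  by apply/negP => /lr; rewrite /= xl.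
exact: lr.
Qed.

Lemma erase_sprout k t : uniq (leaves t) ->
  [seq erase (sprout k x t) | x <- leaves t] = grow (erase t).
Proof.
elim: t => [y _|l IHl j r IHr] /=; first by rewrite eqxx.
move=> lr; move: (lr); rewrite cat_uniq => /and3P[ul _ ur].
rewrite map_cat -(IHl ul) -(IHr ur) -!map_comp; congr (_ ++ _);
  apply/eq_in_map => x /= x_in; have [xl xr] := leaves_cat_disjoint x lr.
  by rewrite (@sprout_id k x r) // xl.
by rewrite (@sprout_id k x l) // xr.
Qed.

Lemma leaves_sprout k x t : uniq (leaves t) -> x \in leaves t ->
  perm_eq (leaves (sprout k x t)) [:: a k x, b k x & rem x (leaves t)].
Proof.
elim: t => [y _|l IHl j r IHr] /=; first by rewrite inE => /eqP ->; rewrite eqxx.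
move=> lr; move: (lr); rewrite cat_uniq => /and3P[ul _ ur].
have [xl xr] := leaves_cat_disjoint x lr.
rewrite rem_filter // filter_cat mem_cat => /orP[x_in|x_in].
  rewrite (@sprout_id k x r) ?xl // -rem_filter //.
  rewrite (_ : [seq y <- leaves r | _] = leaves r).
    by rewrite -cat_cons -cat_cons perm_cat2r IHl.
  by apply/all_filterP/allP => y yr /=; apply: contraTneq yr => ->; exact: xl.
rewrite (@sprout_id k x l) ?xr // -(rem_filter _ ur).
rewrite (_ : [seq y <- leaves l | _] = leaves l); last first.
  by apply/all_filterP/allP => y yl /=; apply: contraTneq yl => ->; exact: xr.
rewrite -[in X in perm_eq _ X]cat1s -[in X in perm_eq _ X](cat1s (b k x)) catA.
rewrite perm_sym perm_catCA perm_cat2l perm_sym; exact: IHr.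
Qed.

Lemma nodes_sprout k x t : uniq (leaves t) -> x \in leaves t ->
  perm_eq (nodes (sprout k x t)) (k :: nodes t).
Proof.
elim: t => [y _|l IHl j r IHr] /=; first by rewrite inE => /eqP ->; rewrite eqxx.
move=> lr; move: (lr); rewrite cat_uniq => /and3P[ul _ ur].
have [xl xr] := leaves_cat_disjoint x lr.
have swap s : perm_eq [:: k, j & s] [:: j, k & s].
  by rewrite -(cat1s k) -(cat1s j) perm_catCA.
rewrite mem_cat => /orP[x_in|x_in].
  rewrite (@sprout_id k x r) ?xl // perm_sym (perm_trans (swap _)) // perm_cons.
  by rewrite -cat_cons perm_cat2r perm_sym IHl.
rewrite (@sprout_id k x l) ?xr // perm_sym (perm_trans (swap _)) // perm_cons.
by rewrite -cat1s perm_catCA perm_cat2l /= perm_sym IHr.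
Qed.

Variable x0 : X.

(* Histories are listed backwards: the last leaf to sprout comes first. *)
Fixpoint tree_of (h : seq X) : ltree :=
  if h is x :: h' then sprout (size h') x (tree_of h') else Leaf x0.

Fixpoint histories (n : nat) : seq (seq X) :=
  if n is n'.+1 then
    [seq x :: h | h <- histories n', x <- leaves (tree_of h)]
  else [:: [::]].

Fixpoint history (beta : nat -> X) (n : nat) : seq X :=
  if n is n'.+1 then beta n' :: history beta n' else [::].

Lemma size_history beta n : size (history beta n) = n.
Proof. by elim: n => //= n ->. Qed.

Lemma eq_history beta beta' n : (forall k, (k < n)%N -> beta k = beta' k) ->
  history beta n = history beta' n.
Proof.
elim: n => //= n IH bb; rewrite bb // IH // => k kn; apply: bb; exact: ltnW.
Qed.

Lemma history_inj beta beta' n : history beta n = history beta' n ->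
  forall k, (k < n)%N -> beta k = beta' k.
Proof.
elim: n => //= n IH [bn hh] k; rewrite ltnS leq_eqVlt => /predU1P[->|] //.
exact: IH.
Qed.

Lemma mem_history beta n x :
  reflect (exists2 k, (k < n)%N & x = beta k) (x \in history beta n).
Proof.
elim: n => [|n IH] /=; first by constructor=> -[].
rewrite inE; apply: (iffP orP) => [[/eqP->|/(elimT IH)[k kn ->]]|[k]].
- by exists n.
- by exists k => //; exact: ltnW.
- rewrite ltnS leq_eqVlt => /predU1P[->|kn] xk; first by left; apply/eqP.
  by right; apply: (introT IH); exists k.
Qed.

Lemma historyP beta n :
  reflect (forall k, (k < n)%N -> beta k \in leaves (tree_of (history beta k)))
          (history beta n \in histories n).
Proof.
elim: n => [|n IH] /=; first by rewrite inE eqxx; constructor.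
apply: (iffP allpairsPdep) => [[h [x [hn xh [bx bh]]]]|H].
  move=> k; rewrite ltnS leq_eqVlt => /predU1P[->|kn].
    by rewrite bx bh.
  by apply: (elimT IH) kn; rewrite bh.
exists (history beta n), (beta n); split => //; last exact: H.
by apply: (introT IH) => k kn; apply: H; exact: ltnW.
Qed.

(** The earlier history may be assumed valid, which is what makes its set of leaves known when the
    next choice is checked. *)
Lemma history_step beta n :
  (forall k, (k < n)%N -> history beta k \in histories k ->
     beta k \in leaves (tree_of (history beta k))) ->
  history beta n \in histories n.
Proof.
elim: n => [|n IH] H; first by rewrite inE.
have hn : history beta n \in histories n.
  by apply: IH => k kn; apply: H; exact: ltnW.
by apply/allpairsPdep; exists (history beta n), (beta n); split => //; exact: H.
Qed.

Lemma history_prefix beta n k : history beta n \in histories n -> (k <= n)%N ->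
  history beta k \in histories k.
Proof.
by move=> /historyP H kn; apply/historyP => j jk; apply: H; exact: leq_trans kn.
Qed.

Lemma history_of n h : h \in histories n -> exists beta, h = history beta n.
Proof.
elim: n h => [|n IH] h /=; first by rewrite inE => /eqP ->; exists (fun=> x0).
move=> /allpairsPdep[h' [x [/IH[beta ->] _ ->]]].
exists (fun k => if k == n then x else beta k); rewrite eqxx; congr cons.
by apply: eq_history => k kn; rewrite ltn_eqF.
Qed.

Hypothesis leaves_uniq : forall n h, h \in histories n -> uniq (leaves (tree_of h)).

Lemma histories_uniq n : uniq (histories n).
Proof.
elim: n => //= n IH; apply: allpairs_uniq_dep => //; first exact: leaves_uniq.
by move=> [h x] [h' x'] _ _ /= [-> ->].
Qed.

Lemma erase_histories n : [seq erase (tree_of h) | h <- histories n] = trees n.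
Proof.
elim: n => //= n <-; rewrite map_allpairs -!map_comp /=; congr flatten.
by apply/eq_in_map => h hn /=; rewrite -(erase_sprout (size h)) // (leaves_uniq hn).
Qed.

(** [beta t] reads off the choices that build the structure [t]. The hypotheses make this a
    bijection from [S] onto the histories, whose erased trees form the list [trees n], repetitions
    included. *)
Lemma count_histories (T : finType) (S : {set T}) (beta : T -> nat -> X) n
    (Q : pred T) (q : pred shape) :
  (forall t, t \in S -> history (beta t) n \in histories n) ->
  {in S &, forall t t', history (beta t) n = history (beta t') n -> t = t'} ->
  (forall h, h \in histories n -> exists2 t, t \in S & h = history (beta t) n) ->
  (forall t, t \in S -> Q t = q (erase (tree_of (history (beta t) n)))) ->
  #|[pred t in S | Q t]| = count q (trees n).
Proof.
move=> Sh Sinj hS Qq; rewrite -erase_histories count_map.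
have pe : perm_eq [seq history (beta t) n | t <- enum S] (histories n).
  apply: uniq_perm; last 1 first.
  - move=> h; apply/mapP/idP => [[t]|/hS[t tS ->]].
      by rewrite mem_enum => tS ->; exact: Sh.
    by exists t; rewrite ?mem_enum.
  - rewrite map_inj_in_uniq ?enum_uniq // => t t'; rewrite !mem_enum; exact: Sinj.
  - exact: histories_uniq.
rewrite -(permP pe) count_map.
rewrite (eq_in_count (a2 := Q)); last by move=> t; rewrite mem_enum => /Qq ->.
rewrite cardE /enum_mem size_filter count_filter; apply: eq_count => t /=.
by rewrite andbC.
Qed.

End LabelledTrees.

(** * From labelled shapes to adjacency matrices *)

Section Placement.
Variables (R : realFieldType) (m : nat).
Implicit Types (t : ltree nat).

Definition unit_row (v : nat) : 'rV[R]_m := \row_(j < m) (j == v :> nat)%:R.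

Definition sym_outer (x y : 'rV[R]_m) : 'M[R]_m := x^T *m y + y^T *m x.

Lemma sym_outerDr (x y z : 'rV[R]_m) : sym_outer x (y + z) = sym_outer x y + sym_outer x z.
Proof. by rewrite /sym_outer mulmxDr linearD mulmxDl addrACA. Qed.

Lemma sym_outer0 (x : 'rV[R]_m) : sym_outer x 0 = 0.
Proof. by rewrite /sym_outer mulmx0 trmx0 mul0mx addr0. Qed.

Lemma sym_outerC (x y : 'rV[R]_m) : sym_outer x y = sym_outer y x.
Proof. exact: addrC. Qed.

Lemma sum_unit_row : \sum_(v <- iota 0 m) (unit_row v)^T *m unit_row v = 1%:M.
Proof.
have -> : iota 0 m = index_iota 0 m by rewrite /index_iota subn0.
rewrite big_mkord.
apply/matrixP => i j; rewrite summxE !mxE (bigD1 i) //= big1 => [|k ki].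
  by rewrite !mxE big_ord1 !mxE eqxx mul1r addr0 eq_sym.
by rewrite !mxE big_ord1 !mxE eq_sym (inj_eq val_inj) (negPf ki) mul0r.
Qed.

(** Increasing labels prevent two vertices from being each other's parent, so every edge is counted
    once; the root contributes 0. *)
Lemma adjacency_underlying (p : parent_map m) :
  (forall v u, p v = Some u -> (u < v)%N) ->
  adjacency R (underlying_graph p) =
  \sum_(v < m) sym_outer (unit_row v) (oapp (fun u : 'I_m => unit_row u) 0 (p v)).
Proof.
move=> p_lt; apply/matrixP => i j; rewrite summxE mxE /underlying_graph.
have entry (v k l : 'I_m) (x : 'rV[R]_m) : ((unit_row v)^T *m x) k l = (k == v)%:R * x 0 l.
  by rewrite !mxE big_ord1 !mxE (inj_eq val_inj).
have entry_tr (v k l : 'I_m) (x : 'rV[R]_m) : (x^T *m unit_row v) k l = (l == v)%:R * x 0 k.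
  by rewrite !mxE big_ord1 !mxE (inj_eq val_inj) mulrC.
have par (v k : 'I_m) : (oapp (fun u : 'I_m => unit_row u) 0 (p v)) 0 k
    = (p v == Some k)%:R.
  case: (p v) => [u|] /=; last by rewrite mxE.
  by rewrite mxE (inj_eq val_inj) eq_sym.
rewrite (eq_bigr (fun v => (i == v)%:R * (p v == Some j)%:R
    + (j == v)%:R * (p v == Some i)%:R)) => [|v _]; last first.
  by rewrite mxE entry entry_tr !par.
have pick (k l : 'I_m) : \sum_v (k == v)%:R * (p v == Some l)%:R
    = (p k == Some l)%:R :> R.
  rewrite (bigD1 k) //= eqxx mul1r big1 ?addr0 // => v vk.
  by rewrite eq_sym (negPf vk) mul0r.
rewrite big_split /= !pick.
have [ij|] /= := eqVneq (p i) (Some j); last by rewrite add0r.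
have [ji|] /= := eqVneq (p j) (Some i); last by rewrite addr0.
by have := ltn_trans (p_lt _ _ ij) (p_lt _ _ ji); rewrite ltnn.
Qed.

Lemma tips_erase (X : eqType) (t : ltree X) : tips (erase t) = size (leaves t).
Proof. by elim: t => //= l -> k r ->; rewrite size_cat. Qed.

Lemma forks_erase (X : eqType) (t : ltree X) : forks (erase t) = size (nodes t).
Proof. by elim: t => //= l -> k r ->; rewrite size_cat add1n. Qed.

(* In a labelled shape of a recursive tree, the leaves carry the vertices. *)
Fixpoint rec_place t : 'M[R]_(tips (erase t), m) :=
  match t with
  | Leaf v => unit_row v
  | Node l _ r => col_mx (rec_place l) (rec_place r)
  end.

Fixpoint rec_top t : nat :=
  match t with Leaf v => v | Node _ _ r => rec_top r end.

Fixpoint rec_edges t : 'M[R]_m :=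
  if t is Node l _ r then
    rec_edges l + rec_edges r + sym_outer (unit_row (rec_top l)) (unit_row (rec_top r))
  else 0.

Lemma rec_root_place t : rec_root R (erase t) *m rec_place t = unit_row (rec_top t).
Proof.
elim: t => [v|l _ k r IHr] /=; first by rewrite mul1mx.
by rewrite mul_row_col mul0mx add0r.
Qed.

Lemma outer_place (k l : nat) (P : 'M[R]_(k, m)) (Q : 'M[R]_(l, m))
    (x : 'rV[R]_k) (y : 'rV[R]_l) :
  P^T *m (x^T *m y) *m Q = (x *m P)^T *m (y *m Q).
Proof. by rewrite trmx_mul !mulmxA. Qed.

Lemma rec_adj_place t :
  (rec_place t)^T *m rec_adj R (erase t) *m rec_place t = rec_edges t.
Proof.
elim: t => [v|l IHl k r IHr] /=; first by rewrite mulmx0 mul0mx.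
rewrite tr_col_mx mul_row_block mul_row_col !mulmxDl IHl IHr.
rewrite !outer_place !rec_root_place.
by rewrite [X in _ + X]addrC addrACA [X in _ + X]addrC.
Qed.

Lemma rec_place_gram t :
  (rec_place t)^T *m rec_place t = \sum_(v <- leaves t) (unit_row v)^T *m unit_row v.
Proof.
elim: t => [v|l IHl k r IHr] /=; first by rewrite big_seq1.
by rewrite tr_col_mx mul_row_col big_cat /= IHl IHr.
Qed.

(** Step [k] attaches the vertex [k.+1] to [x]: the new vertex becomes the left leaf, while [x]
    remains on the right as the last leaf, that is, as the root of its part. *)
Definition rec_left (k _ : nat) : nat := k.+1.
Definition rec_right (_ x : nat) : nat := x.
Local Notation rec_sprout := (sprout rec_left rec_right).

Lemma rec_top_sprout k x t : rec_top (rec_sprout k x t) = rec_top t.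
Proof. by elim: t => //= y; case: eqVneq => [->|]. Qed.

Lemma rec_edges_sprout k x t : uniq (leaves t) -> x \in leaves t ->
  rec_edges (rec_sprout k x t) = rec_edges t + sym_outer (unit_row k.+1) (unit_row x).
Proof.
elim: t => [y _|l IHl j r IHr] /=.
  by rewrite inE => /eqP ->; rewrite eqxx /= !add0r.
move=> lr; move: (lr); rewrite cat_uniq => /and3P[ul _ ur].
have [xl xr] := leaves_cat_disjoint x lr.
rewrite !rec_top_sprout mem_cat => /orP[x_in|x_in].
  by rewrite (@sprout_id _ _ _ k x r) ?xl // IHl // [RHS]addrAC [X in X + _ = _]addrAC.
by rewrite (@sprout_id _ _ _ k x l) ?xr // IHr // [X in X + _ = _]addrA [RHS]addrAC.
Qed.

(* In a labelled binary tree, the nodes carry the vertices and the leaves carry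
   the free child slots, [None] being the slot of the root of the whole tree. *)
Definition slot : eqType := option (nat * bool).
Definition bin_left (k : nat) (_ : slot) : slot := Some (k, false).
Definition bin_right (k : nat) (_ : slot) : slot := Some (k, true).
Local Notation bin_sprout := (sprout bin_left bin_right).
Implicit Types (s q : ltree slot).

Fixpoint bin_place s : 'M[R]_(forks (erase s), m) :=
  match s with
  | Leaf _ => 0
  | Node l k r => col_mx (unit_row k) (col_mx (bin_place l) (bin_place r))
  end.

Definition bin_top s : 'rV[R]_m := if s is Node _ k _ then unit_row k else 0.

Fixpoint bin_edges s : 'M[R]_m :=
  if s is Node l k r then
    bin_edges l + bin_edges r + sym_outer (unit_row k) (bin_top l + bin_top r)
  else 0.

Lemma bin_root_place s : bin_root R (erase s) *m bin_place s = bin_top s.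
Proof.
case: s => [v|l k r] /=; first by rewrite mul0mx.
by rewrite mul_row_col mul0mx addr0 mul1mx.
Qed.

Lemma bin_adj_place s :
  (bin_place s)^T *m bin_adj R (erase s) *m bin_place s = bin_edges s.
Proof.
elim: s => [v|l IHl k r IHr] /=; first by rewrite mulmx0.
set w := row_mx (bin_root R _) _; set D := block_mx (bin_adj R _) _ _ _.
set Q := col_mx (bin_place l) _.
have wQ : w *m Q = bin_top l + bin_top r by rewrite mul_row_col !bin_root_place.
have DQ : Q^T *m D *m Q = bin_edges l + bin_edges r.
  by rewrite tr_col_mx mul_row_block !mulmx0 addr0 add0r mul_row_col IHl IHr.
rewrite tr_col_mx mul_row_block mul_row_col mulmx0 add0r mulmxDl DQ -trmx_mul wQ.
by rewrite -(mulmxA _ w Q) wQ /sym_outer addrC addrAC addrC.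
Qed.

Lemma bin_place_gram s :
  (bin_place s)^T *m bin_place s = \sum_(v <- nodes s) (unit_row v)^T *m unit_row v.
Proof.
elim: s => [v|l IHl k r IHr] /=; first by rewrite big_nil mulmx0.
by rewrite !tr_col_mx !mul_row_col big_cons big_cat /= IHl IHr.
Qed.

(** [s] hangs in the slot [x], and each of its leaves is labelled by the slot where it really is. *)
Fixpoint well_placed (x : slot) s : bool :=
  match s with
  | Leaf y => y == x
  | Node l k r => well_placed (Some (k, false)) l && well_placed (Some (k, true)) r
  end.

Definition slot_row (x : slot) : 'rV[R]_m := oapp (fun us => unit_row us.1) 0 x.

Lemma well_placed_sprout k x y s : well_placed y s -> well_placed y (bin_sprout k x s).
Proof.
elim: s y => [z|l IHl j r IHr] y /=.
  by move=> /eqP ->; case: eqP => _ /=; rewrite ?eqxx.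
by move=> /andP[/IHl -> /IHr ->].
Qed.

(** [bin_edges s] lacks the edge that joins [s] to the owner of its slot [y]. Sprouting a bare leaf
    creates just this edge, so the induction needs it on both sides. *)
Lemma bin_edges_sprout k x y s : well_placed y s -> uniq (leaves s) -> x \in leaves s ->
  bin_edges (bin_sprout k x s) + sym_outer (slot_row y) (bin_top (bin_sprout k x s)) =
  bin_edges s + sym_outer (slot_row y) (bin_top s) + sym_outer (unit_row k) (slot_row x).
Proof.
elim: s y => [z|l IHl j r IHr] y /=.
  move=> /eqP -> _; rewrite inE => /eqP ->; rewrite eqxx /=.
  by rewrite !addr0 !sym_outer0 !add0r sym_outerC.
move=> /andP[wl wr] lr; move: (lr); rewrite cat_uniq => /and3P[ul _ ur].
have [xl xr] := leaves_cat_disjoint x lr.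
rewrite mem_cat !sym_outerDr => /orP[x_in|x_in].
  rewrite (@sprout_id _ _ _ k x r) ?xl //.
  have IH := IHl _ wl ul x_in; rewrite /slot_row /= -/(slot_row x) in IH.
  rewrite [X in X + _ = _]addrACA IH [X in _ = X + _ + _]addrACA.
  by rewrite [X in X + _ = _]addrAC [LHS]addrAC.
rewrite (@sprout_id _ _ _ k x l) ?xr //.
have IH := IHr _ wr ur x_in; rewrite /slot_row /= -/(slot_row x) in IH.
rewrite [X in X + _ = _]addrACA IH [X in _ = X + _ + _]addrACA.
by rewrite [X in X + _ = _]addrA [LHS]addrAC.
Qed.

End Placement.

(** * The two random tree models as growth histories *)

Section Models.
Variables (R : realFieldType) (a : R).

(** Parents have smaller labels, so [ord0] can only be the root, and conversely following parents
    always ends there. *)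
Lemma increasing_rooted_treeP n (p : parent_map n.+1) :
  reflect (p ord0 = None /\
           forall v, v != ord0 -> exists2 u, p v = Some u & (u < v)%N)
          (is_rooted_tree p && increasing_labels p).
Proof.
apply: (iffP andP) => [[/existsP[r /andP[/eqP pr /forallP con]] /forallP inc]|[p0 pS]].
  have lt v u : p v = Some u -> (u < v)%N.
    by move=> pv; have /forallP/(_ v) := inc u; rewrite pv eqxx.
  have root v : p v = None -> v = r.
    move=> pv; have /connectP[[|x s] //=] := con v.
    by rewrite pv.
  have p0 : p ord0 = None by case E: (p ord0) => [u|//]; have := lt _ _ E.
  split=> // v v0; case E: (p v) => [u|]; first by exists u => //; exact: lt.
  by rewrite (root _ E) -(root _ p0) eqxx in v0.
split; last first.
  apply/forallP => u; apply/forallP => v; apply/implyP => /eqP pv.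
  have [v0|v0] := eqVneq v ord0; first by rewrite v0 p0 in pv.
  by have [w pw wv] := pS v v0; move: pv; rewrite pw => -[<-].
apply/existsP; exists ord0; rewrite p0 eqxx /=; apply/forallP => v.
have [k] := ubnP (v : nat); elim: k v => // k IH v /ltnSE vk.
have [->|v0] := eqVneq v ord0; first exact: connect0.
have [u pv uv] := pS v v0.
apply: connect_trans (IH u (leq_trans uv vk)).
by apply: connect1; rewrite /= pv.
Qed.

Section Recursive.
Local Notation tree := (tree_of rec_left rec_right 0%N).
Local Notation histories := (histories rec_left rec_right 0%N).

Lemma rec_leaves n h : h \in histories n ->
  size h = n /\ perm_eq (leaves (tree h)) (iota 0 n.+1).
Proof.
elim: n h => [|n IH] h; first by rewrite inE => /eqP ->.
move=> /allpairsPdep[h' [x [/IH[sh ph] xh ->]]] /=; rewrite sh; split => //.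
have u : uniq (leaves (tree h')) by rewrite (perm_uniq ph) iota_uniq.
apply: perm_trans (leaves_sprout _ _ _ u xh) _.
apply: perm_trans (_ : perm_eq (n.+1 :: leaves (tree h')) _).
  by rewrite perm_cons perm_sym perm_to_rem.
apply: perm_trans (_ : perm_eq (n.+1 :: iota 0 n.+1) _); first by rewrite perm_cons.
have e : iota 0 n.+2 = iota 0 n.+1 ++ [:: n.+1] by rewrite -(addn1 n.+1) iotaD.
by rewrite -[X in perm_eq _ X]/(iota 0 n.+2) e -cat1s perm_catC.
Qed.

Lemma rec_leaves_uniq n h : h \in histories n -> uniq (leaves (tree h)).
Proof. by move=> /rec_leaves[_ ph]; rewrite (perm_uniq ph) iota_uniq. Qed.

Lemma rec_edges_history (m : nat) (beta : nat -> nat) n :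
  history beta n \in histories n ->
  rec_edges R m (tree (history beta n)) =
  \sum_(0 <= k < n) sym_outer (unit_row R m k.+1) (unit_row R m (beta k)).
Proof.
elim: n => [|n IH]; first by rewrite big_nil.
move=> H; have Hn := history_prefix H (leqnSn n).
move/historyP: H => H.
rewrite big_nat_recr //= -IH // size_history.
by rewrite rec_edges_sprout ?(rec_leaves_uniq Hn) // H.
Qed.

(** Step [k] chooses the parent of the vertex [k.+1], which is not the root when [k < n]; there the
    default 0 is not reached in a recursive tree. *)
Definition rec_beta n (p : parent_map n.+1) (k : nat) : nat :=
  oapp (@nat_of_ord n.+1) 0%N (p (inord k.+1)).

Variable n : nat.
Implicit Types p : parent_map n.+1.

Let inordS (v : 'I_n.+1) : v != ord0 -> exists2 k, (k < n)%N & v = inord k.+1.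
Proof.
case: v => [[|k] kn] //= v0; exists k => //.
by apply: val_inj; rewrite /= inordK.
Qed.

Let rec_betaE p u k : p (inord k.+1) = Some u -> rec_beta p k = u.
Proof. by rewrite /rec_beta => ->. Qed.

Lemma recursive_parent p k : p \in recursive_trees n.+1 -> (k < n)%N ->
  exists2 u : 'I_n.+1, p (inord k.+1) = Some u & (u <= k)%N.
Proof.
rewrite inE => /increasing_rooted_treeP[_ pS] kn.
have k0 : (inord k.+1 : 'I_n.+1) != ord0 by rewrite -val_eqE /= inordK.
by have [u pu] := pS _ k0; rewrite inordK // ltnS; exists u.
Qed.

Lemma rec_history p : p \in recursive_trees n.+1 ->
  history (rec_beta p) n \in histories n.
Proof.
move=> pR; apply: history_step => k kn hk.
have [_ ph] := rec_leaves hk; rewrite (perm_mem ph) mem_iota /= add0n.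
by have [u pu uk] := recursive_parent pR kn; rewrite (rec_betaE pu) ltnS.
Qed.

Lemma rec_history_inj : {in recursive_trees n.+1 &, forall p p',
  history (rec_beta p) n = history (rec_beta p') n -> p = p'}.
Proof.
move=> p p' pR p'R /history_inj pp'; apply/ffunP => v.
have [->|v0] := eqVneq v ord0.
  move: pR p'R; rewrite !inE => /increasing_rooted_treeP[-> _].
  by move=> /increasing_rooted_treeP[-> _].
have [k kn ->] := inordS v0.
have [u pu _] := recursive_parent pR kn; have [u' pu' _] := recursive_parent p'R kn.
rewrite pu pu'; congr Some; apply: val_inj.
by rewrite /= -(rec_betaE pu) -(rec_betaE pu') pp'.
Qed.

Lemma rec_history_surj h : h \in histories n ->
  exists2 p, p \in recursive_trees n.+1 & h = history (rec_beta p) n.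
Proof.
move=> hn; have [beta hE] := history_of hn; rewrite hE in hn.
have beta_le k : (k < n)%N -> (beta k <= k)%N.
  move=> kn; have [_ ph] := rec_leaves (history_prefix hn (ltnW kn)).
  by move/historyP: hn => /(_ k kn); rewrite (perm_mem ph) mem_iota /= add0n ltnS.
pose p : parent_map n.+1 :=
  [ffun v : 'I_n.+1 => if v == ord0 then None else Some (inord (beta v.-1))].
exists p; last first.
  rewrite hE; apply: eq_history => k kn.
  rewrite /rec_beta ffunE -val_eqE /= inordK //= inordK //.
  by rewrite ltnS (leq_trans (beta_le k kn)) // ltnW.
rewrite inE; apply/increasing_rooted_treeP; split; first by rewrite ffunE eqxx.
move=> v v0; exists (inord (beta v.-1)); first by rewrite ffunE (negPf v0).
have [k kn ->] := inordS v0; rewrite !inordK //=; first by rewrite ltnS beta_le.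
by rewrite ltnS (leq_trans (beta_le k kn)) // ltnW.
Qed.

Lemma rec_eigen_mult p : p \in recursive_trees n.+1 ->
  eigen_mult (underlying_graph p) a =
  rec_mult a (erase (tree (history (rec_beta p) n))).
Proof.
move=> pR; have hn := rec_history pR.
have [_ ph] := rec_leaves hn.
apply: (@mup_char_poly_relabel _ _ _ _ (rec_place R n.+1 (tree (history (rec_beta p) n)))).
- by rewrite tips_erase (perm_size ph) size_iota.
- by rewrite rec_place_gram (perm_big _ ph) sum_unit_row.
- rewrite rec_adj_place rec_edges_history // adjacency_underlying; last first.
    move=> v u pv; move: pR; rewrite inE => /increasing_rooted_treeP[p0 pS].
    have [v0|/pS[w]] := eqVneq v ord0; first by rewrite v0 p0 in pv.
    by rewrite pv => -[->].
  rewrite big_mkord [RHS]big_ord_recl.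
  have -> : p ord0 = None by move: pR; rewrite inE => /increasing_rooted_treeP[].
  rewrite sym_outer0 add0r; apply: eq_bigr => k _.
  have -> : lift ord0 k = inord k.+1 by apply: val_inj; rewrite /= inordK // ltnS.
  have [u pu _] := recursive_parent pR (ltn_ord k).
  by rewrite (rec_betaE pu) pu inordK // ltnS.
- exact: tr_rec_adj.
Qed.

Lemma count_recursive_trees (Q : pred nat) :
  #|[pred p in recursive_trees n.+1 | Q (eigen_mult (underlying_graph p) a)]| =
  count (fun t => Q (rec_mult a t)) (trees n).
Proof.
apply: (count_histories (@rec_leaves_uniq) (beta := @rec_beta n)).
- exact: rec_history.
- exact: rec_history_inj.
- exact: rec_history_surj.
- by move=> p pR; rewrite rec_eigen_mult.
Qed.

End Recursive.

Section Binary.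
Local Notation tree := (tree_of bin_left bin_right (None : slot)).
Local Notation histories := (histories bin_left bin_right (None : slot)).

Definition slot_lt (x : slot) (n : nat) : bool :=
  if x is Some (u, _) then (u < n)%N else true.

Lemma slot_ltW x n : slot_lt x n -> slot_lt x n.+1.
Proof. by case: x => //= -[u _]; exact: ltnW. Qed.

(** The invariant of the growth: the leaves are exactly the free slots, those of existing vertices
    (or [None]) that no earlier step has used. *)
Lemma bin_leaves n h : h \in histories n ->
  [/\ size h = n, uniq (leaves (tree h)), well_placed None (tree h),
      perm_eq (nodes (tree h)) (iota 0 n) &
      (forall x, x \in h -> slot_lt x n) /\
      (forall x, (x \in leaves (tree h)) = (x \notin h) && slot_lt x n)].
Proof.
elim: n h => [|n IH] h.
  rewrite inE => /eqP ->; split => //; split => // x.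
  by case: x => [[u s]|].
move=> /allpairsPdep[h' [x [/IH[sh uh wh ph [lth memh]] xh ->]]] /=; rewrite sh.
have ps := leaves_sprout bin_left bin_right n uh xh.
have /andP[xh' xn] : (x \notin h') && slot_lt x n by rewrite -memh.
have new s : Some (n, s) \notin leaves (tree h') by rewrite memh /= ltnn andbF.
split; first by [].
- have nr s : Some (n, s) \notin rem x (leaves (tree h')).
    by apply: contra (new s) => /mem_rem.
  have ft : (Some (n, false) : slot) != Some (n, true) by apply/eqP.
  by rewrite (perm_uniq ps) /= inE negb_or /bin_left /bin_right !nr ft rem_uniq.
- exact: well_placed_sprout.
- apply: perm_trans (nodes_sprout _ _ _ uh xh) _.
  apply: perm_trans (_ : perm_eq (n :: iota 0 n) _); first by rewrite perm_cons.
  have e : iota 0 n.+1 = iota 0 n ++ [:: n] by rewrite -(addn1 n) iotaD.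
  by rewrite -[X in perm_eq _ X]/(iota 0 n.+1) e -cat1s perm_catC.
split => y.
  by rewrite inE => /predU1P[->|/lth]; exact: slot_ltW.
rewrite (perm_mem ps) !inE mem_rem_uniq // inE memh negb_or /bin_left /bin_right.
have [->|yf] := eqVneq y (Some (n, false)).
  rewrite /= ltnSn andbT; symmetry; apply/andP; split.
    by apply: contraNneq (new false) => ->.
  by apply/negP => /lth /=; rewrite ltnn.
have [->|yt] := eqVneq y (Some (n, true)).
  rewrite /= ltnSn andbT; symmetry; apply/andP; split.
    by apply: contraNneq (new true) => ->.
  by apply/negP => /lth /=; rewrite ltnn.
rewrite /= -andbA; congr (_ && (_ && _)).
case: y yf yt => [[u s]|] //= yf yt; rewrite ltnS [RHS]leq_eqVlt.
by case: eqVneq => // un; move: yf yt; rewrite un; case: (s); rewrite ?eqxx.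
Qed.

Lemma bin_leaves_uniq n h : h \in histories n -> uniq (leaves (tree h)).
Proof. by case/bin_leaves. Qed.

Lemma bin_edges_history (m : nat) (beta : nat -> slot) n :
  history beta n \in histories n ->
  bin_edges R m (tree (history beta n)) =
  \sum_(0 <= k < n) sym_outer (unit_row R m k) (slot_row R m (beta k)).
Proof.
elim: n => [|n IH]; first by rewrite big_nil.
move=> H; have Hn := history_prefix H (leqnSn n).
have [_ un wn _ _] := bin_leaves Hn.
rewrite big_nat_recr //= -IH // size_history.
have /historyP/(_ n (ltnSn n)) bn := H.
have := bin_edges_sprout R m n wn un bn.
by rewrite /= ![sym_outer (slot_row R m None) _]sym_outerC !sym_outer0 !addr0.
Qed.

Variable n : nat.
Implicit Types b : binary_map n.+1.

Definition bin_beta b (k : nat) : slot :=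
  omap (fun us : 'I_n.+1 * bool => (us.1 : nat, us.2)) (b (inord k)).

Lemma binary_treeP b :
  reflect [/\ b ord0 = None,
      forall v, v != ord0 -> exists2 us, b v = Some us & (us.1 < v)%N
    & forall v w us, b v = Some us -> b w = Some us -> v = w]
  (b \in binary_increasing_trees n.+1).
Proof.
rewrite inE /is_binary_tree andbAC; apply: (iffP andP).
  move=> [/increasing_rooted_treeP[b0 bS] /forallP bc]; split.
  - by move: b0; rewrite ffunE; case: (b ord0).
  - by move=> v /bS[u]; rewrite ffunE; case: (b v) => //= us [<-]; exists us.
  move=> v w [u s] bv bw; have /forallP/(_ s)/card_le1_eqP := bc u.
  by apply; rewrite inE ?bv ?bw.
move=> [b0 bS binj]; split.
  apply/increasing_rooted_treeP; split; first by rewrite ffunE b0.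
  by move=> v /bS[us bv us_lt]; exists us.1; rewrite ?ffunE ?bv.
apply/forallP => u; apply/forallP => s; apply/card_le1_eqP => v w.
by rewrite !inE => /eqP bv /eqP bw; exact: binj bw bv.
Qed.

Let inord_neq0 k : (k < n.+1)%N -> (0 < k)%N -> (inord k : 'I_n.+1) != ord0.
Proof. by move=> kn k0; rewrite -val_eqE /= inordK // -lt0n. Qed.

Lemma bin_betaS b k : b \in binary_increasing_trees n.+1 -> (k < n.+1)%N ->
  (0 < k)%N -> exists us : 'I_n.+1 * bool,
  [/\ b (inord k) = Some us, bin_beta b k = Some (us.1 : nat, us.2) & (us.1 < k)%N].
Proof.
move=> /binary_treeP[_ bS _] kn k0.
have [us bk] := bS _ (inord_neq0 kn k0); rewrite inordK // => us_lt.
by exists us; rewrite /bin_beta bk.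
Qed.

Lemma bin_beta0 b : b \in binary_increasing_trees n.+1 -> bin_beta b 0 = None.
Proof.
move=> /binary_treeP[b0 _ _]; rewrite /bin_beta.
have -> : inord 0 = ord0 :> 'I_n.+1 by apply: val_inj; rewrite /= inordK.
by rewrite b0.
Qed.

Let pair_val_inj (us us' : 'I_n.+1 * bool) :
  (us.1 : nat, us.2) = (us'.1 : nat, us'.2) -> us = us'.
Proof. by case: us us' => [u s] [u' s'] [/= /val_inj -> ->]. Qed.

Lemma bin_history b : b \in binary_increasing_trees n.+1 ->
  history (bin_beta b) n.+1 \in histories n.+1.
Proof.
move=> bB; apply: history_step => k kn hk.
have [_ _ _ _ [_ ->]] := bin_leaves hk.
have [->|k0] := posnP k; first by rewrite bin_beta0.
have [us [bk bbk us_lt]] := bin_betaS bB kn k0.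
(* If an earlier vertex [j] had used this slot, two vertices would be the same child of one
   parent. *)
rewrite bbk /= us_lt andbT; apply/negP => /mem_history[j jk].
have [->|j0] := posnP j; first by rewrite bin_beta0.
have jn := ltn_trans jk kn.
have [us' [bj -> _]] := bin_betaS bB jn j0 => -[/val_inj u1 u2].
have uu : us = us' by apply: pair_val_inj; rewrite u1 u2.
have /binary_treeP[_ _ binj] := bB.
rewrite -uu in bj; have := binj _ _ _ bk bj; move/(congr1 val); rewrite /= !inordK //.
by move=> kj; rewrite kj ltnn in jk.
Qed.

Lemma bin_history_inj : {in binary_increasing_trees n.+1 &, forall b b',
  history (bin_beta b) n.+1 = history (bin_beta b') n.+1 -> b = b'}.
Proof.
move=> b b' _ _ /history_inj bb'; apply/ffunP => v.
have := bb' v (ltn_ord v); rewrite /bin_beta inord_val.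
case: (b v) (b' v) => [us|] [us'|] //= [u1 u2].
by congr Some; apply: pair_val_inj; rewrite u1 u2.
Qed.

Lemma bin_history_surj h : h \in histories n.+1 ->
  exists2 b, b \in binary_increasing_trees n.+1 & h = history (bin_beta b) n.+1.
Proof.
move=> hn; have [beta hE] := history_of hn; rewrite hE in hn.
have beta_in k : (k < n.+1)%N ->
    (beta k \notin history beta k) && slot_lt (beta k) k.
  move=> kn; have [_ _ _ _ [_ <-]] := bin_leaves (history_prefix hn (ltnW kn)).
  by move/historyP: hn => /(_ k kn).
have beta0 : beta 0%N = None.
  by have := beta_in 0%N (ltn0Sn n); case: (beta 0%N) => // -[u s].
(* Step 0 uses up the slot [None], so every later vertex has a parent. *)
have betaS k : (k < n.+1)%N -> (0 < k)%N ->
    exists us : nat * bool, beta k = Some us /\ (us.1 < k)%N.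
  move=> kn k0; have := beta_in k kn; case: (beta k) => [[u s]|] /=.
    by move=> /andP[_ uk]; exists (u, s).
  by rewrite andbT => /negP[]; apply/mem_history; exists 0%N.
have beta_inj j k : (j < n.+1)%N -> (k < n.+1)%N -> beta j = beta k -> j = k.
  wlog jk : j k / (j < k)%N.
    move=> H jn kn jk; have [jk'|kj|//] := ltngtP j k; first exact: H.
    by apply/esym/H.
  move=> _ kn bjk; have /andP[/negP[]] := beta_in k kn.
  by apply/mem_history; exists j.
pose b : binary_map n.+1 := [ffun v : 'I_n.+1 =>
  omap (fun us : nat * bool => (inord us.1 : 'I_n.+1, us.2)) (beta v)].
have bE k : (k < n.+1)%N -> bin_beta b k = beta k.
  move=> kn; rewrite /bin_beta ffunE inordK //.
  have [->|k0] := posnP k; first by rewrite beta0.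
  have [[u s] [-> uk]] := betaS k kn k0; rewrite /= inordK //.
  exact: ltn_trans uk kn.
exists b; last by rewrite hE; apply: eq_history => k kn; rewrite bE.
apply/binary_treeP; split.
- by rewrite ffunE beta0.
- move=> v v0; have v0' : (0 < v)%N by rewrite lt0n; apply: contraNneq v0 => v0; apply/eqP/val_inj.
  have [[u s] [bv uv]] := betaS v (ltn_ord v) v0'.
  exists (inord u, s); first by rewrite ffunE bv.
  by rewrite /= inordK // (ltn_trans uv).
move=> v w us bv bw; apply: val_inj; apply: (beta_inj _ _ (ltn_ord v) (ltn_ord w)).
have := bE v (ltn_ord v); have := bE w (ltn_ord w).
by rewrite /bin_beta !inord_val bv bw => ew ev; exact: etrans (esym ev) ew.
Qed.

Lemma bin_eigen_mult b : b \in binary_increasing_trees n.+1 ->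
  eigen_mult (underlying_graph (forget_sides b)) a =
  bin_mult a (erase (tree (history (bin_beta b) n.+1))).
Proof.
move=> bB; have hn := bin_history bB.
have [_ _ _ ph _] := bin_leaves hn.
apply: (@mup_char_poly_relabel _ _ _ _ (bin_place R n.+1 (tree (history (bin_beta b) n.+1)))).
- by rewrite forks_erase (perm_size ph) size_iota.
- by rewrite bin_place_gram (perm_big _ ph) sum_unit_row.
- have /binary_treeP[b0 bS _] := bB.
  rewrite bin_adj_place bin_edges_history // adjacency_underlying; last first.
    move=> v u; rewrite ffunE; have [->|/bS[us ->]] := eqVneq v ord0; first by rewrite b0.
    by move=> us_lt [<-].
  rewrite big_mkord; apply: eq_bigr => v _.
  by rewrite ffunE /bin_beta inord_val; case: (b v).
- exact: tr_bin_adj.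
Qed.

Lemma count_binary_trees (Q : pred nat) :
  #|[pred b in binary_increasing_trees n.+1
      | Q (eigen_mult (underlying_graph (forget_sides b)) a)]| =
  count (fun t => Q (bin_mult a t)) (trees n.+1).
Proof.
apply: (count_histories (@bin_leaves_uniq) (beta := bin_beta)).
- exact: bin_history.
- exact: bin_history_inj.
- exact: bin_history_surj.
- by move=> b bB; rewrite bin_eigen_mult.
Qed.

End Binary.
End Models.

(** * From counting histories to convergence in distribution *)

Section Conclusion.
Variable R : realType.
Local Open Scope classical_set_scope.

Lemma expect_indicE (n : nat) (P : pred shape) :
  expect n (fun t => (P t)%:R) = (count P (trees n))%:R / (size (trees n))%:R :> R.
Proof.
rewrite /expect natr_size_trees; congr (_ / _).
rewrite -sum1_count natr_sum [RHS]big_mkcond; apply: eq_bigr => t _.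
by case: (P t).
Qed.

(** Along the points [- harmonic n], which increase to 0, the distribution function is 0, but at 0
    it is 1. *)
Lemma dirac_cdf_discontinuous (x : R) :
  {for x, continuous (distr_fun (\d_(0 : R)))} -> x != 0.
Proof.
move=> cx; apply/eqP => x0; rewrite {}x0 in cx.
pose u : nat -> R := fun n => - harmonic n.
have u0 : u @ \oo --> (0 : R).
  by rewrite -[X in _ --> X]oppr0; apply: cvgN; exact: cvg_harmonic.
have c1 := cvg_comp _ _ u0 cx.
have c0 : distr_fun (\d_(0 : R)) \o u @ \oo --> (0 : \bar R).
  rewrite (_ : _ \o u = cst 0%E); first exact: cvg_cst.
  apply/funext => n /=; rewrite /distr_fun diracE memNset //= in_itv /= /u.
  by rewrite leNgt oppr_lt0 invr_gt0 ltr0n.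
have e : 0%E = distr_fun (\d_(0 : R)) 0 := cvg_unique (@ereal_hausdorff R) c0 c1.
have : distr_fun (\d_(0 : R)) 0 = 1%E.
  by rewrite /distr_fun diracE mem_set //= in_itv /=.
by rewrite -e => /eqP; rewrite eqe eq_sym oner_eq0.
Qed.

Lemma distr_fun_normal_law (sigma2 x : R) : 0 <= sigma2 ->
  {for x, continuous (distr_fun (normal_law 0 sigma2))} ->
  (sigma2 = 0 -> x != 0) /\
  distr_fun (normal_law 0 sigma2) x = (limit_cdf sigma2 x)%:E.
Proof.
rewrite /normal_law /limit_cdf; have [-> _ /dirac_cdf_discontinuous x0|s0 s_ge0 _] :=
  eqVneq sigma2 0; split => //.
- rewrite /distr_fun diracE; congr (_%:R%:E); congr nat_of_bool.
  have [x_gt0|x_le0] := ltP 0 x.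
    by apply: mem_set; rewrite /= in_itv /= ltW.
  apply: memNset; rewrite /= in_itv /= => x_ge0.
  by move: x0; rewrite eq_le x_le0 x_ge0.
- by move=> s0'; rewrite s0' eqxx in s0.
- by rewrite /distr_fun normal_probE normal_cdf_scale // sqrtr_gt0 lt0r s0.
Qed.

(* [d] relates the size of a structure to the number of forks of its shape. *)
Lemma multiplicity_clt (mult : shape -> nat) (c d : nat) (T : nat -> finType)
    (S : forall n, {set T n}) (N : forall n, T n -> nat) : (d <= 1)%N ->
  (mult Tip <= c.+1)%N ->
  (forall l r, (mult (Fork l r) <= mult l + mult r + c.+1 /\
                mult l + mult r <= mult (Fork l r) + c.+1)%N) ->
  (forall n (Q : pred nat), #|[pred t in S n.+1 | Q (N n.+1 t)]| =
     count (fun t => Q (mult t)) (trees (n + d))) ->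
  exists mu sigma2 : R, 0 <= sigma2 /\
    cvg_in_distribution
      (fun n => uniform_law (S n)
         (fun t => ((N n t)%:R - mu * n%:R) / Num.sqrt n%:R))
      (normal_law 0 sigma2).
Proof.
move=> d1 mult_Tip mult_Fork countE.
pose F t : R := (mult t)%:R.
have F_Tip : `|F Tip| <= c.+1%:R by rewrite ger0_norm // ler_nat.
have F_Fork l r : `|F (Fork l r) - F l - F r| <= c.+1%:R.
  have [] := mult_Fork l r; rewrite -!(ler_nat R) !natrD => h1 h2.
  by rewrite ler_norml /F; apply/andP; split; lra.
have [mu [sigma2 [s0 clt]]] := additive_clt (ltr0n R c.+1) F_Tip F_Fork.
exists mu, sigma2; split => // x cx.
have [x0 ->] := distr_fun_normal_law s0 cx.
(* A shape with [k = n + d] forks codes a structure of size [k.+1 - d = n.+1]. *)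
pose zeta k : R := mu * (k.+1 - d)%:R + x * Num.sqrt (k.+1 - d)%:R.
have zetaP k : `|zeta k - mu * k.+1%:R - x * Num.sqrt k.+1%:R| <= `|mu| + `|x|.
  have dk : (k.+1 - d)%:R = k.+1%:R - d%:R :> R by rewrite natrB // (leq_trans d1).
  have s1 : `|Num.sqrt (k.+1 - d)%:R - Num.sqrt k.+1%:R| <= 1 :> R.
    have a0 := sqrtr_ge0 ((k.+1 - d)%:R : R); have b0 := sqrtr_ge0 (k.+1%:R : R).
    have aE := sqr_sqrtr (ler0n R (k.+1 - d)); have bE := sqr_sqrtr (ler0n R k.+1).
    have d0 : 0 <= d%:R :> R := ler0n R d.
    have d1' : d%:R <= 1 :> R by rewrite lern1.
    have ab : Num.sqrt (k.+1 - d)%:R <= Num.sqrt k.+1%:R :> R.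
      by rewrite ler_sqrt // ler_nat leq_subr.
    have b1 : 1 <= Num.sqrt k.+1%:R :> R.
      by rewrite -[X in X <= _](@sqrtr1 R) ler_sqrt ?ler1n.
    rewrite [RHS]dk -bE in aE; move: ab a0 b0 b1 aE {bE}.
    move: (Num.sqrt (k.+1 - d)%:R) (Num.sqrt k.+1%:R) => p q pq p0 q0 q1 pE.
    by rewrite ler_norml; apply/andP; split; nra.
  rewrite (_ : _ - _ = mu * - d%:R + x * (Num.sqrt (k.+1 - d)%:R - Num.sqrt k.+1%:R)).
    rewrite (le_trans (ler_normD _ _)) // !normrM lerD ?ler_piMr //.
    by rewrite normrN ger0_norm // lern1.
  by rewrite /zeta dk; ring.
have {}clt := clt zeta x _ zetaP x0.
(* Size 0, where the uniform law is the zero measure, is skipped. *)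
rewrite -(cvg_shiftS (fun n => distr_fun _ x)).
rewrite (_ : (fun n => _) = EFin \o (fun n => expect (n + d) (fun t => (F t <= zeta (n + d)%N)%R%:R))).
  apply: cvg_EFin; first exact: nearW.
  by move: clt; rewrite -(cvg_shiftn d).
apply/funext => n /=; rewrite /distr_fun /uniform_law expect_indicE; congr (_%:E).
have SE : #|S n.+1| = size (trees (n + d)).
  by rewrite -(count_predT (trees (n + d))) -(countE n predT); apply: eq_card => t; rewrite !inE andbT.
rewrite SE; congr (_%:R / _).
pose Q k := ((k%:R - mu * n.+1%:R) / Num.sqrt n.+1%:R <= x)%R.
have sn : 0 < Num.sqrt n.+1%:R :> R by rewrite sqrtr_gt0.
transitivity #|[pred t in S n.+1 | Q (N n.+1 t)]|.
  apply: eq_card => t; rewrite !inE; congr (_ && _); rewrite /Q.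
  by apply/idP/idP; rewrite inE /= in_itv.
rewrite countE; apply: eq_count => t; rewrite /Q /zeta /F.
rewrite (_ : ((n + d).+1 - d)%N = n.+1); last by rewrite -addSn addnK.
by rewrite ler_pdivrMr // lerBlDr addrC.
Qed.

End Conclusion.

Theorem theorem3p1 (R : realType) (alpha : R) :
  ((exists (m : nat) (e : rel 'I_m),
      is_tree e /\ eigenvalue (adjacency R e) alpha) ->
   exists mu sigma2 : R, 0 <= sigma2 /\
     cvg_in_distribution
       (fun n => uniform_law (recursive_trees n)
          (fun p => ((eigen_mult (underlying_graph p) alpha)%:R - mu * n%:R)
                      / Num.sqrt n%:R))
       (normal_law 0 sigma2))
  /\
  ((exists (m : nat) (b : binary_map m),
      is_binary_tree b /\
      eigenvalue (adjacency R (underlying_graph (forget_sides b))) alpha) ->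
   exists mu sigma2 : R, 0 <= sigma2 /\
     cvg_in_distribution
       (fun n => uniform_law (binary_increasing_trees n)
          (fun b => ((eigen_mult (underlying_graph (forget_sides b)) alpha)%:R
                       - mu * n%:R) / Num.sqrt n%:R))
       (normal_law 0 sigma2)).
Proof.
split=> _.
(* The toll is at most 2 here and 3 in the binary case. A recursive tree with [n.+1] vertices has a
   shape with [n] forks, a binary one a shape with [n.+1]. *)
- apply: (@multiplicity_clt R (rec_mult alpha) 1 0 parent_map recursive_trees
    (fun n p => eigen_mult (underlying_graph p) alpha)) => //.
  + by apply: leq_trans (rec_mult_Tip alpha) _.
  + exact: rec_mult_Fork.
  + by move=> n Q; rewrite addn0; exact: count_recursive_trees.
- apply: (@multiplicity_clt R (bin_mult alpha) 2 1 binary_map binary_increasing_trees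
    (fun n b => eigen_mult (underlying_graph (forget_sides b)) alpha)) => //.
  + by rewrite bin_mult_Tip.
  + exact: bin_mult_Fork.
  + by move=> n Q; rewrite addn1; exact: count_binary_trees.
Qed.
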